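(* Every countable dense subset $T\subset\mathbb{S}^{d-1}$ contains a universal sequence, i.e. there exists a sequence $(u_n)_{n\geq1}$ of elements of $T$ which is universal.
   Context: Let $d$ be a positive integer, $\mathbb{S}^{d-1}$ the Euclidean unit sphere of $\mathbb{R}^d$, $D$ the closed unit ball centered at the origin, and $\mathcal{K}_d$ the set of convex bodies of $\mathbb{R}^d$ (convex compact sets with nonempty interior), endowed with the Hausdorff distance $d_H$; all convergences of sets are for $d_H$. Steiner symmetrization: for $A\in\mathcal{K}_d$ and $u\in\mathbb{S}^{d-1}$, view $A$ as a family of line segments parallel to $u$; $S_uA$ is the set obtained by sliding each of these segments along $u$ so that its midpoint lies in $u^\perp$. Minkowski symmetrization: $B_uA=\frac12(A\oplus\pi_u(A))$, where $\pi_u$ is the orthogonal reflection with respect to $u^\perp$ and $\oplus$ is the Minkowski sum. The support function of $A$ is $f_A(\theta)=\sup_{x\in A}\langle x,\theta\rangle$, and the mean radius is $L(A)=\int_{\mathbb{S}^{d-1}}f_A\,d\sigma$, with $\sigma$ the rotation-invariant probability measure on $\mathbb{S}^{d-1}$. The number $r(A)>0$ is such that $r(A)D$ has the same volume as $A$. For a sequence $(u_n)_{n\geq1}$ in $\mathbb{S}^{d-1}$ and $n\geq k\geq1$ put $S_{k,n}A=S_{u_n}(\ldots S_{u_{k+1}}(S_{u_k}A)\ldots)$ and $B_{k,n}A=B_{u_n}(\ldots B_{u_{k+1}}(B_{u_k}A)\ldots)$. The sequence is $S$-universal if for every $A\in\mathcal{K}_d$ and every $k\geq1$, $S_{k,n}A\to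 r(A)D$ as $n\to\infty$; it is $M$-universal if for every $A\in\mathcal{K}_d$ and every $k\geq1$, $B_{k,n}A\to L(A)D$ as $n\to\infty$. These two notions coincide, and a sequence satisfying them is called universal (i.e. it is both $S$-universal and $M$-universal). *)

(* Defs.v *)
From HB Require Import structures.
From mathcomp Require Import all_boot all_order all_algebra.
From mathcomp Require Import all_classical all_reals all_analysis.
Set Implicit Arguments.
Unset Strict Implicit.
Unset Printing Implicit Defensive.
Import Order.TTheory GRing.Theory Num.Theory.
Import numFieldNormedType.Exports.
Local Open Scope classical_set_scope.
Local Open Scope ring_scope.

Section Euclidean.
Variables (R : realType) (d : nat).
Implicit Types (x y u : 'rV[R]_d) (A B : set 'rV[R]_d).

(* The library norm on ['rV[R]_d] is the sup norm; it induces the same topology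
   as [enorm], so [compact], [interior] and [closure] can be used as they are. *)
Definition dotv x y : R := \sum_i x ord0 i * y ord0 i.

Definition enorm x : R := Num.sqrt (dotv x x).

Definition sphere : set 'rV[R]_d := [set u | enorm u = 1].

Definition unit_ball : set 'rV[R]_d := [set x | enorm x <= 1].

Definition dilate (r : R) A : set 'rV[R]_d := [set r *: x | x in A].

Definition minkowski_sum A B : set 'rV[R]_d := [set x + y | x in A & y in B].

Definition convex_body A : Prop :=
  [/\ convex_set (A : set (convex_lmodType 'rV[R]_d)), compact A & interior A !=set0].

(* Extended-real valued, so that no junk value arises for unbounded sets. *)
Definition hausdorff_dist A B : \bar R :=
  ereal_inf [set r%:E | r in [set r : R |
    [/\ 0 <= r, A `<=` minkowski_sum B (dilate r unit_ball)
              & B `<=` minkowski_sum A (dilate r unit_ball)]]].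

Definition hausdorff_cvg (A_ : nat -> set 'rV[R]_d) B : Prop :=
  hausdorff_dist (A_ n) B @[n --> \oo] --> (0 : R)%:E.

(* Below, [u] is meant to be a unit vector. *)
Definition proj_orth u x : 'rV[R]_d := x - dotv x u *: u.

Definition reflection u x : 'rV[R]_d := x - (2 * dotv x u) *: u.

(* Coordinates along [u], with origin in the hyperplane orthogonal to [u], of the
   points of [A] on the line through [x] parallel to [u]. *)
Definition chord u A x : set R := [set t | A (proj_orth u x + t *: u)].

Definition chord_mid u A x : R := 2^-1 * (inf (chord u A x) + sup (chord u A x)).

(* Each point slides along [u] with the chord containing it, by the amount that
   brings the midpoint of this chord into the hyperplane orthogonal to [u]. *)
Definition steiner u A : set 'rV[R]_d := [set x - chord_mid u A x *: u | x in A].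

Definition minkowski_sym u A : set 'rV[R]_d :=
  dilate 2^-1 (minkowski_sum A (reflection u @` A)).

Definition support_fun A (theta : 'rV[R]_d) : R := sup [set dotv x theta | x in A].

(* [R^d] with its Borel sigma-algebra *)
Definition borel_rV := g_sigma_algebraType (@open 'rV[R]_d).

(* The measure on the sphere is represented by a Borel probability on [R^d]
   carried by the sphere. Invariance is under the full orthogonal group, which
   determines the measure in every dimension; the proper rotations alone would
   not do so when [d = 1]. *)
Definition rotation_invariant_on_sphere (sigma : probability borel_rV R) : Prop :=
  sigma sphere = 1%E /\
  forall (O : 'M[R]_d) (E : set borel_rV), O *m O^T = 1%:M -> measurable E ->
    sigma ((fun x : borel_rV => (x : 'rV[R]_d) *m O) @^-1` E) = sigma E.

Definition mean_radius (sigma : probability borel_rV R) A : R :=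
  \int[sigma]_(theta in sphere) support_fun A theta.

End Euclidean.

(* The d-dimensional Lebesgue measure: the d-fold product of [lebesgue_measure],
   written with the integral over sections that defines the product measure in
   the library. It is only meant for Borel sets (in particular convex bodies). *)
Fixpoint volume (R : realType) (d : nat) : set 'rV[R]_d -> \bar R :=
  match d return set 'rV[R]_d -> \bar R with
  | 0 => fun A => (\1_A (0 : 'rV[R]_0) : R)%:E
  | d'.+1 => fun A =>
      (\int[@lebesgue_measure R]_t
         volume [set y : 'rV[R]_d' | A (row_mx (t : R)%:M y : 'rV[R]_(1 + d'))])%E
  end.

Section Universal.
Variables (R : realType) (d : nat).
Implicit Types (A : set 'rV[R]_d) (u : nat -> 'rV[R]_d).

Definition volume_radius A : R :=
  xget 0 [set r : R | 0 < r /\ volume (dilate r (@unit_ball R d)) = volume A].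

(* [F (u n) (... (F (u k.+1) (F (u k) A)))]; sequences are indexed from 0. *)
Definition iter_sym (F : 'rV[R]_d -> set 'rV[R]_d -> set 'rV[R]_d) u (k n : nat) A :=
  foldl (fun B i => F (u i) B) A (index_iota k n.+1).

Definition S_universal u : Prop :=
  forall A, convex_body A -> forall k : nat,
    hausdorff_cvg (fun n => iter_sym (@steiner R d) u k n A)
                  (dilate (volume_radius A) (@unit_ball R d)).

Definition M_universal (sigma : probability (borel_rV R d) R) u : Prop :=
  forall A, convex_body A -> forall k : nat,
    hausdorff_cvg (fun n => iter_sym (@minkowski_sym R d) u k n A)
                  (dilate (mean_radius sigma A) (@unit_ball R d)).

Definition universal (sigma : probability (borel_rV R d) R) u : Prop :=
  [/\ forall n, sphere (u n), S_universal u & M_universal sigma u].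

End Universal.

(* Main.v *)
From HB Require Import structures.
Require Import Defs.
From mathcomp Require Import all_boot all_order all_algebra.
From mathcomp Require Import all_classical all_reals all_analysis.
From mathcomp Require Import measurable_realfun ring lra.
Set Implicit Arguments.
Unset Strict Implicit.
Unset Printing Implicit Defensive.
Import Order.TTheory GRing.Theory Num.Theory.
Import numFieldNormedType.Exports.
Local Open Scope classical_set_scope.
Local Open Scope ring_scope.

(* Let f_A be the support function of A. Then f_(B_u A) is the average of f_A and
   of f_A composed with the reflection in u, and S_u A is contained in B_u A, so
   both symmetrizations satisfy f_(new) <= (f_A + f_A o reflection) / 2: the
   maximum of the support function never increases. Enumerate T as t_0, t_1, ...
   and let (u_n) contain every initial segment t_0, ..., t_N as a block of
   consecutive terms infinitely often. If N is such that t_0, ..., t_N is fine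
   enough in the sphere, then any direction is sent by one of the reflections of
   the block close to a direction where the support function is below its maximum
   by delta; one block therefore lowers the maximum by at least a constant
   depending only on N and delta. As the maximum is bounded below, at some
   time the support function oscillates by less than delta, i.e. the body is
   sandwiched between two concentric balls whose radii differ by delta. Later
   steps keep it there. The radius is identified by the conserved quantity: the
   mean radius for B_u, and the volume for S_u. *)

(** * Euclidean geometry *)

Section Euclidean_space.
Variables (R : realType) (d : nat).
Implicit Types (x y z u : 'rV[R]_d) (A B C : set 'rV[R]_d) (t : R).

Lemma dotvC x y : dotv x y = dotv y x.
Proof. by apply: eq_bigr => i _; rewrite mulrC. Qed.

Lemma dotvDl x y z : dotv (x + y) z = dotv x z + dotv y z.
Proof. by rewrite -big_split; apply: eq_bigr => i _ /=; rewrite mxE mulrDl. Qed.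

Lemma dotvZl t x y : dotv (t *: x) y = t * dotv x y.
Proof. by rewrite big_distrr; apply: eq_bigr => i _ /=; rewrite mxE mulrA. Qed.

Lemma dotvDr x y z : dotv x (y + z) = dotv x y + dotv x z.
Proof. by rewrite dotvC dotvDl !(dotvC x). Qed.

Lemma dotvZr t x y : dotv x (t *: y) = t * dotv x y.
Proof. by rewrite dotvC dotvZl dotvC. Qed.

Lemma dotvNl x y : dotv (- x) y = - dotv x y.
Proof. by rewrite -scaleN1r dotvZl mulN1r. Qed.

Lemma dotvNr x y : dotv x (- y) = - dotv x y.
Proof. by rewrite dotvC dotvNl dotvC. Qed.

Definition dotvE := (dotvDl, dotvDr, dotvNl, dotvNr, dotvZl, dotvZr).

Lemma dot0v x : dotv 0 x = 0.
Proof. by rewrite -(scale0r 0) dotvZl mul0r. Qed.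

Lemma dotvv_ge0 x : 0 <= dotv x x.
Proof. by apply: sumr_ge0 => i _; rewrite -expr2 sqr_ge0. Qed.

Lemma dotvv_eq0 x : dotv x x = 0 -> x = 0.
Proof.
move=> /eqP; rewrite psumr_eq0; last by move=> i _; rewrite -expr2 sqr_ge0.
move=> /allP h; apply/rowP => i; rewrite mxE; apply/eqP.
by have := h i (mem_index_enum _); rewrite -expr2 sqrf_eq0.
Qed.

Lemma enorm_ge0 x : 0 <= enorm x.
Proof. exact: sqrtr_ge0. Qed.

Lemma sqr_enorm x : enorm x ^+ 2 = dotv x x.
Proof. by rewrite sqr_sqrtr // dotvv_ge0. Qed.

Lemma enorm_eq0 x : enorm x = 0 -> x = 0.
Proof. by move=> h; apply: dotvv_eq0; rewrite -sqr_enorm h expr0n. Qed.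

Lemma enormZ t x : enorm (t *: x) = `|t| * enorm x.
Proof.
by rewrite /enorm !dotvE mulrA -expr2 sqrtrM ?sqr_ge0 // sqrtr_sqr.
Qed.

Lemma enormN x : enorm (- x) = enorm x.
Proof. by rewrite -scaleN1r enormZ normrN1 mul1r. Qed.

Lemma enormB x y : enorm (x - y) = enorm (y - x).
Proof. by rewrite -enormN opprB. Qed.

Lemma dotv_le_enorm x y : dotv x y <= enorm x * enorm y.
Proof.
have [->|x0] := eqVneq x 0; first by rewrite dot0v mulr_ge0 ?enorm_ge0.
have X0 : 0 < enorm x.
  by rewrite lt_neqAle enorm_ge0 andbT eq_sym; apply/eqP => /enorm_eq0/eqP; apply/negP.
(* The squared norm of this vector is [2 * enorm x * enorm y * (enorm x * enorm y - dotv x y)]; the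
   positive factor is divided out below. *)
have := dotvv_ge0 (enorm y *: x - enorm x *: y).
rewrite !dotvE -!sqr_enorm (dotvC y x) => h.
have [y0|Y0] := eqVneq (enorm y) 0.
  by rewrite (enorm_eq0 y0) dotvC dot0v mulr_ge0 ?enorm_ge0.
have {}Y0 : 0 < enorm y by rewrite lt_neqAle enorm_ge0 eq_sym Y0.
rewrite -(ler_pM2l (mulr_gt0 X0 Y0)); nra.
Qed.

Lemma ler_enormD x y : enorm (x + y) <= enorm x + enorm y.
Proof.
rewrite -(ler_pXn2r (n := 2)) ?nnegrE ?addr_ge0 ?enorm_ge0 //.
rewrite sqr_enorm !dotvE -!sqr_enorm (dotvC y x).
have := dotv_le_enorm x y; nra.
Qed.

Lemma enorm_unit x : sphere x -> dotv x x = 1.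
Proof. by rewrite /sphere /= => h; rewrite -sqr_enorm h expr1n. Qed.

Lemma sphere_dotv x : dotv x x = 1 -> sphere x.
Proof. by rewrite /sphere /= /enorm => ->; rewrite sqrtr1. Qed.

Lemma enorm_gt0 x : x != 0 -> 0 < enorm x.
Proof.
by move=> x0; rewrite lt_neqAle enorm_ge0 andbT eq_sym; apply/eqP => /enorm_eq0/eqP; apply/negP.
Qed.

Lemma sphere_normalize x : x != 0 -> sphere ((enorm x)^-1 *: x).
Proof.
move=> /enorm_gt0 x0; rewrite /sphere /= enormZ ger0_norm ?invr_ge0 ?enorm_ge0 //.
by rewrite mulVf ?gt_eqF.
Qed.

Lemma sphereN x : sphere x -> sphere (- x).
Proof. by rewrite /sphere /= enormN. Qed.

Lemma coord_le_enorm x i : `|x ord0 i| <= enorm x.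
Proof.
rewrite -(ler_pXn2r (n := 2)) ?nnegrE ?enorm_ge0 // sqr_enorm real_normK ?num_real //.
rewrite /dotv (bigD1 i) //= -expr2 lerDl.
by apply: sumr_ge0 => j _; rewrite -expr2 sqr_ge0.
Qed.

(** The factor [d] is cruder than its square root, but it only serves to compare the topologies and
    bounded sets of the two norms. *)
Lemma enorm_le_coord x t : 0 <= t -> (forall i, `|x ord0 i| <= t) ->
  enorm x <= d%:R * t.
Proof.
move=> t0 h; rewrite -(ler_pXn2r (n := 2)) ?nnegrE ?enorm_ge0 ?mulr_ge0 //.
rewrite sqr_enorm /dotv; apply: (@le_trans _ _ (\sum_(i < d) t ^+ 2)).
  by apply: ler_sum => i _; rewrite -expr2 -real_normK ?num_real // lerXn2r ?nnegrE.
rewrite sumr_const card_ord -[_ *+ d]mulr_natl exprMn ler_wpM2r ?sqr_ge0 //.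
by case: (d) => [|n]; rewrite ?expr0n // expr2 ler_peMl // ler1n.
Qed.

Lemma rV_norm_le x t : 0 <= t -> (forall i, `|x ord0 i| <= t) -> `|x| <= t.
Proof.
move=> t0 h; rewrite [leLHS]/Num.norm /= mx_normrE; apply/bigmax_leP; split => // -[i j] _ /=.
by rewrite (ord1 i).
Qed.

Lemma coord_le_norm x i : `|x ord0 i| <= `|x|.
Proof.
by rewrite [leRHS]/Num.norm /= mx_normrE; apply/bigmax_geP; right => /=; exists (ord0, i).
Qed.

Lemma norm_le_enorm x : `|x| <= enorm x.
Proof. by apply: rV_norm_le; [exact: enorm_ge0|exact: coord_le_enorm]. Qed.

Lemma enorm_le_norm x : enorm x <= d%:R * `|x|.
Proof. by apply: enorm_le_coord => // i; exact: coord_le_norm. Qed.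

Lemma near_enorm_lt x t : 0 < t -> \forall y \near x, enorm (y - x) < t.
Proof.
move=> t0; apply/nbhs_ballP; exists (t / (d%:R + 1)) => /=; first by rewrite divr_gt0.
move=> y; rewrite mx_norm_ball /ball_ /= => xy; rewrite enormB.
apply: (le_lt_trans (enorm_le_norm _)).
move: xy; rewrite ltr_pdivlMr ?ltr_wpDl // => xy; apply: le_lt_trans xy.
by rewrite mulrC ler_wpM2l // lerDl.
Qed.

Lemma dotvl_continuous y : continuous (fun x => dotv x y).
Proof.
apply: continuous_big => [|i _ x]; first exact: add_continuous.
apply: (@continuousM _ _ (fun x : 'rV[R]_d => x ord0 i) (fun=> y ord0 i)).
  exact: coord_continuous.
exact: cst_continuous.
Qed.

Lemma enorm_continuous : continuous (@enorm R d).
Proof.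
move=> x; apply: continuous_comp; last exact: sqrt_continuous.
move: x; apply: continuous_big => [|i _ x]; first exact: add_continuous.
by apply: (@continuousM _ _ (fun x : 'rV[R]_d => x ord0 i) (fun x : 'rV[R]_d => x ord0 i)); exact: coord_continuous.
Qed.

Lemma closed_sphere : closed (@sphere R d).
Proof.
change (closed (@enorm R d @^-1` [set 1])).
by apply: preimage_closed => [x _|]; [exact: enorm_continuous|exact: closed_eq].
Qed.

Lemma enorm_bounded_set A K : (forall x, A x -> enorm x <= K) -> bounded_set A.
Proof.
move=> h; exists K; split; first exact: num_real.
move=> M KM x Ax; apply: (le_trans (norm_le_enorm x)).
exact: (le_trans (h _ Ax) (ltW KM)).
Qed.

Lemma compact_enorm_le A : compact A -> exists2 K, 0 <= K & forall x, A x -> enorm x <= K.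
Proof.
move=> /compact_bounded[M [_ h]]; exists (d%:R * (`|M| + 1)) => [|x Ax].
  by rewrite mulr_ge0 // addr_ge0.
apply: (le_trans (enorm_le_norm x)); rewrite ler_wpM2l //.
by apply: h => //; rewrite (le_lt_trans (ler_norm M)) // ltrDl.
Qed.

Lemma compact_sphere : compact (@sphere R d).
Proof.
apply: bounded_closed_compact closed_sphere.
by apply: (@enorm_bounded_set _ 1) => x ->.
Qed.

Lemma reflection_dotv u x y : sphere u ->
  dotv (reflection u x) (reflection u y) = dotv x y.
Proof. move=> /enorm_unit uu; rewrite /reflection !dotvE uu (dotvC u y); ring. Qed.

Lemma dotv_reflection u x y : dotv (reflection u x) y = dotv x (reflection u y).
Proof. rewrite /reflection !dotvE (dotvC u y); ring. Qed.

Lemma reflectionK u : sphere u -> involutive (reflection u).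
Proof.
move=> /enorm_unit uu x; apply/rowP => i; rewrite /reflection !dotvE uu !mxE; ring.
Qed.

Lemma sphere_reflection u x : sphere u -> sphere x -> sphere (reflection u x).
Proof. by move=> uu /enorm_unit xx; apply: sphere_dotv; rewrite reflection_dotv. Qed.

Lemma reflectionD u x y : reflection u (x + y) = reflection u x + reflection u y.
Proof. apply/rowP => i; rewrite /reflection !dotvE !mxE; ring. Qed.

Lemma reflectionZ u t x : reflection u (t *: x) = t *: reflection u x.
Proof. apply/rowP => i; rewrite /reflection !dotvE !mxE; ring. Qed.

Lemma enorm_reflection u x : sphere u -> enorm (reflection u x) = enorm x.
Proof. by move=> uu; rewrite /enorm reflection_dotv. Qed.

Lemma reflection_continuous u : continuous (reflection u).
Proof.
move=> x; apply: (@continuousB _ _ _ id (fun x => (2 * dotv x u) *: u)); first by [].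
apply: (@continuousZ _ _ _ (fun x => 2 * dotv x u) (fun=> u)); last exact: cst_continuous.
apply: (@continuousM _ _ (fun=> 2) (fun x => dotv x u)); first exact: cst_continuous.
exact: dotvl_continuous.
Qed.

End Euclidean_space.

(** * Support functions *)

Section Convex_bodies.
Variables (R : realType) (d : nat).
Implicit Types (x y z u th : 'rV[R]_d) (A B C : set 'rV[R]_d) (t r m M : R).

Definition is_convex A := forall x y t, 0 <= t <= 1 -> A x -> A y ->
  A (t *: x + (1 - t) *: y).

Lemma convex_set_is_convex A :
  convex_set (A : set (convex_lmodType 'rV[R]_d)) -> is_convex A.
Proof.
move=> cA x y t /andP[t0 t1] Ax Ay.
by have := cA x y (Itv01 t0 t1); rewrite !inE; apply.
Qed.

Lemma is_convex_mid A x y : is_convex A -> A x -> A y -> A (2^-1 *: (x + y)).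
Proof.
move=> cA Ax Ay; have := cA x y 2^-1; rewrite scalerDr.
by rewrite (_ : 1 - 2^-1 = 2^-1); [apply => //|]; lra.
Qed.

Definition cball r : set 'rV[R]_d := [set x | enorm x <= r].

Lemma dilate_unit_ball r : 0 <= r -> dilate r (@unit_ball R d) = cball r.
Proof.
move=> r0; apply/seteqP; split => [_ [x x1 <-]|x xr] /=.
  by rewrite /cball /= enormZ ger0_norm // ler_piMr.
have [r_0|r_0] := eqVneq r 0.
  exists 0; first by rewrite /unit_ball /= /enorm dot0v sqrtr0.
  rewrite r_0 scale0r; apply/esym/enorm_eq0/le_anti.
  by rewrite enorm_ge0 -[in X in _ <= X]r_0 xr.
exists (r^-1 *: x); last by rewrite scalerA divff // scale1r.
rewrite /unit_ball /= enormZ ger0_norm ?invr_ge0 // mulrC ler_pdivrMr ?mul1r //.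
by rewrite lt_neqAle eq_sym r_0.
Qed.

Section Support_function.
Variable A : set 'rV[R]_d.
Hypotheses (A0 : A !=set0) (cA : compact A).

Lemma support_fun_le th r : (forall x, A x -> dotv x th <= r) -> support_fun A th <= r.
Proof.
move=> h; apply: ge_sup; first by case: A0 => x Ax; exists (dotv x th), x.
by move=> _ [x Ax <-]; exact: h.
Qed.

Lemma support_fun_ge x th : A x -> dotv x th <= support_fun A th.
Proof.
move=> Ax; have [K K0 hK] := compact_enorm_le cA.
apply: ub_le_sup; last by exists x.
exists (K * enorm th) => _ [y Ay <-]; apply: (le_trans (dotv_le_enorm _ _)).
by rewrite ler_wpM2r ?enorm_ge0 // hK.
Qed.

Lemma support_fun_lipschitz r th th' : A `<=` cball r ->
  support_fun A th <= support_fun A th' + r * enorm (th - th').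
Proof.
move=> h; apply: support_fun_le => x Ax.
rewrite -[th in leLHS](subrK th') addrC dotvDr lerD ?support_fun_ge //.
by apply: (le_trans (dotv_le_enorm _ _)); rewrite ler_wpM2r ?enorm_ge0 //; exact: h.
Qed.

Lemma support_funD_oppr_ge0 th : 0 <= support_fun A th + support_fun A (- th).
Proof.
have [x Ax] := A0; rewrite -(subrr (dotv x th)) -dotvNr.
by rewrite lerD ?support_fun_ge.
Qed.

Lemma sub_cball_support_fun r : 0 <= r ->
  (forall th, sphere th -> support_fun A th <= r) -> A `<=` cball r.
Proof.
move=> r0 h x Ax; rewrite /cball /=.
have [->|x0] := eqVneq x 0; first by rewrite /enorm dot0v sqrtr0.
apply: le_trans (h _ (sphere_normalize x0)); apply: le_trans (support_fun_ge _ Ax).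
rewrite dotvZr -sqr_enorm expr2 mulrA mulVf ?mul1r //.
by rewrite gt_eqF // enorm_gt0.
Qed.

Lemma support_fun_le_cball r th : 0 <= r -> A `<=` cball r -> sphere th ->
  support_fun A th <= r.
Proof.
move=> r0 h sth; apply: support_fun_le => x Ax; apply: (le_trans (dotv_le_enorm _ _)).
by rewrite sth mulr1; exact: h.
Qed.

Lemma cball_sub_support_fun_ge r th : 0 <= r -> cball r `<=` A -> sphere th ->
  r <= support_fun A th.
Proof.
move=> r0 h sth; rewrite -[leLHS]mulr1 -(enorm_unit sth) -dotvZl.
by apply/support_fun_ge/h; rewrite /cball /= enormZ sth mulr1 ger0_norm.
Qed.

(* [p] is the point of [A] nearest to [x]; the test direction is [x - p]. *)
Lemma support_fun_separation x r : is_convex A -> 0 <= r ->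
  (forall th, sphere th -> dotv x th <= support_fun A th + r) ->
  exists2 p, A p & enorm (x - p) <= r.
Proof.
move=> cvA r0 h.
have [p /set_mem Ap pmin] : exists2 p, p \in A & forall y, y \in A -> enorm (x - p) <= enorm (x - y).
  apply: EVT_min_rV => //; apply: continuous_subspaceT => y.
  apply: (@continuous_comp _ _ _ (fun y => x - y) (@enorm R d)); last exact: enorm_continuous.
  apply: (@continuousB _ _ _ (fun=> x) id) => //; exact: cst_continuous.
exists p => //; have [->|xp] := eqVneq x p; first by rewrite subrr /enorm dot0v sqrtr0.
have xp0 : x - p != 0 by rewrite subr_eq0.
have e0 := enorm_gt0 xp0.
have key q : A q -> dotv (q - p) (x - p) <= 0.
  move=> Aq; rewrite leNgt; apply/negP => s0.
  set s := dotv _ _ in s0; set n := dotv (q - p) (q - p).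
  have n0 : 0 <= n by exact: dotvv_ge0.
  (* Moving from [p] towards [q] by [t] changes the squared distance to [x] by
     [t * (t * n - 2 * s)]. Since [t * (s + n) = s], this is negative, against the choice of [p]. *)
  pose t := s / (s + n).
  have sn0 : 0 < s + n by rewrite ltr_wpDr.
  have t0 : 0 < t by rewrite divr_gt0.
  have t1 : t <= 1 by rewrite ler_pdivrMr // mul1r lerDl.
  have := pmin (t *: q + (1 - t) *: p); rewrite inE => /(_ (cvA _ _ _ _ Aq Ap)).
  rewrite t1 ltW // => /(_ isT).
  rewrite (_ : x - (t *: q + (1 - t) *: p) = (x - p) - t *: (q - p)); last first.
    by apply/rowP => i; rewrite !mxE; ring.
  rewrite -(ler_pXn2r (n := 2)) ?nnegrE ?enorm_ge0 // !sqr_enorm.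
  have expand v w : dotv (v - t *: w) (v - t *: w) = dotv v v - 2 * t * dotv w v + t ^+ 2 * dotv w w.
    by rewrite !dotvE (dotvC v w); ring.
  rewrite expand -/s -/n.
  have tsn : t * (s + n) = s by rewrite /t divfK // gt_eqF.
  nra.
have := h _ (sphere_normalize xp0).
have : support_fun A ((enorm (x - p))^-1 *: (x - p)) <= dotv p ((enorm (x - p))^-1 *: (x - p)).
  apply: support_fun_le => q Aq; rewrite -subr_ge0 -opprB oppr_ge0 -dotvNl -dotvDl dotvZr.
  by rewrite mulr_ge0_le0 ?invr_ge0 ?enorm_ge0 // key.
move=> h1 h2; have : dotv (x - p) ((enorm (x - p))^-1 *: (x - p)) <= r.
  by rewrite dotvDl dotvNl; lra.
by rewrite dotvZr -sqr_enorm expr2 mulrA mulVf ?mul1r // gt_eqF.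
Qed.

(** For [x] in the ball, [dotv x th <= r <= support_fun A th] in every unit direction, so nothing
    separates [x] from [A] and its distance to [A] is 0. *)
Lemma cball_sub_support_fun r : is_convex A ->
  (forall th, sphere th -> r <= support_fun A th) -> cball r `<=` A.
Proof.
move=> cvA h x xr; have [th sth|p Ap] := @support_fun_separation x 0 cvA (lexx _).
  rewrite addr0; apply: le_trans (h _ sth).
  by apply: (le_trans (dotv_le_enorm _ _)); rewrite sth mulr1.
by move=> xp; rewrite -(subrK p x) (@enorm_eq0 _ _ (x - p)) ?add0r //; apply/le_anti; rewrite enorm_ge0 andbT.
Qed.

(** Points of [A] have norm at most [r + e] and are moved radially into the ball; a point of the
    ball lies within [e] of [A] by [support_fun_separation]. *)
Lemma hausdorff_dist_support_fun r e : is_convex A -> 0 <= r -> 0 <= e ->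
  (forall th, sphere th -> `|support_fun A th - r| <= e) ->
  (hausdorff_dist A (dilate r (@unit_ball R d)) <= e%:E)%E.
Proof.
move=> cvA r0 e0 h; apply: ereal_inf_lbound; exists e => //; split => //.
  rewrite !dilate_unit_ball // => x Ax.
  have xre : enorm x <= r + e.
    apply: (sub_cball_support_fun (addr_ge0 r0 e0)) Ax.
    by move=> th /h; rewrite ler_norml => /andP[]; lra.
  have [xr|xr] := leP (enorm x) r.
    exists x => //; exists 0; last by rewrite addr0.
    by rewrite /cball /= /enorm dot0v sqrtr0.
  have x0 : 0 < enorm x by exact: le_lt_trans xr.
  have n0 : enorm x != 0 by rewrite gt_eqF.
  exists ((r / enorm x) *: x).
    rewrite /cball /= enormZ ger0_norm ?divfK //.
    by rewrite divr_ge0 // enorm_ge0.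
  exists ((1 - r / enorm x) *: x); last first.
    by rewrite -scalerDl addrCA subrr addr0 scale1r.
  rewrite /cball /= enormZ ger0_norm; last by rewrite subr_ge0 ler_pdivrMr // mul1r ltW.
  by rewrite mulrBl mul1r divfK //; lra.
rewrite !dilate_unit_ball // => x xr.
have [th sth|p Ap xp] := @support_fun_separation x e cvA e0.
  apply: (le_trans (dotv_le_enorm _ _)); rewrite sth mulr1 (le_trans xr) //.
  by have := h _ sth; rewrite ler_norml => /andP[+ _]; lra.
by exists p => //; exists (x - p) => //; rewrite addrC subrK.
Qed.

End Support_function.
End Convex_bodies.

(** * Steiner and Minkowski symmetrals *)

Section Symmetrizations.
Variables (R : realType) (d : nat).
Implicit Types (x y z u th : 'rV[R]_d) (A B C : set 'rV[R]_d) (t r m M : R).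

Lemma proj_orth_cancel u x : proj_orth u x + dotv x u *: u = x.
Proof. by rewrite /proj_orth subrK. Qed.

Lemma dotv_proj_orth u x : sphere u -> dotv (proj_orth u x) u = 0.
Proof. by move=> /enorm_unit uu; rewrite /proj_orth !dotvE uu; ring. Qed.

Lemma proj_orth_line u x t : sphere u -> proj_orth u (x + t *: u) = proj_orth u x.
Proof.
by move=> /enorm_unit uu; apply/rowP => i; rewrite /proj_orth !dotvE uu !mxE; ring.
Qed.

Lemma proj_orthK u x : sphere u -> proj_orth u (proj_orth u x) = proj_orth u x.
Proof. by move=> uu; rewrite [X in proj_orth u X = _]/proj_orth -scaleNr proj_orth_line. Qed.

Lemma proj_orth_reflection u x : sphere u -> proj_orth u (reflection u x) = proj_orth u x.
Proof. by move=> uu; rewrite /reflection -scaleNr proj_orth_line. Qed.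

Lemma dotv_line u x t : sphere u -> dotv (proj_orth u x + t *: u) u = t.
Proof.
by move=> uu; rewrite dotvDl dotv_proj_orth // dotvZl enorm_unit // mulr1 add0r.
Qed.

(** Support functions are additive under Minkowski sums, and a reflection is its own adjoint. *)
Lemma support_fun_minkowski_sym u A th : A !=set0 -> compact A ->
  support_fun (minkowski_sym u A) th = 2^-1 * (support_fun A th + support_fun A (reflection u th)).
Proof.
move=> A0 cA.
have val a b : dotv (2^-1 *: (a + reflection u b)) th = 2^-1 * (dotv a th + dotv b (reflection u th)).
  by rewrite dotvZl dotvDl dotv_reflection.
have S0 : minkowski_sym u A !=set0.
  have [a Aa] := A0; exists (2^-1 *: (a + reflection u a)), (a + reflection u a) => //.
  by exists a => //; exists (reflection u a) => //; exists a.
apply/le_anti/andP; split.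
  apply: support_fun_le => // _ [_ [a Aa [_ [b Ab <-] <-]] <-].
  by rewrite val ler_pM2l ?invr_gt0 // lerD ?support_fun_ge.
(* The two points vary independently, so the suprema over [a] and [b] can be taken one after the
   other in this bound. *)
have ub a b : A a -> A b ->
    dotv a th + dotv b (reflection u th) <= 2 * support_fun (minkowski_sym u A) th.
  move=> Aa Ab; rewrite -ler_pdivrMl // -val.
  apply: ub_le_sup; last first.
    exists (2^-1 *: (a + reflection u b)) => //; exists (a + reflection u b) => //.
    by exists a => //; exists (reflection u b) => //; exists b.
  exists (2^-1 * (support_fun A th + support_fun A (reflection u th))).
  move=> _ [_ [_ [a' Aa' [_ [b' Ab' <-] <-]] <-] <-].
  by rewrite val ler_pM2l ?invr_gt0 // lerD ?support_fun_ge.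
rewrite ler_pdivrMl // -lerBrDr; apply: support_fun_le => // a Aa.
rewrite lerBrDr addrC -lerBrDr; apply: support_fun_le => // b Ab.
by rewrite lerBrDr addrC ub.
Qed.

(** Both symmetrals are images of compact sets of pairs under this map, whence their compactness. *)
Lemma mid_reflection_continuous u :
  continuous (fun p : 'rV[R]_d * 'rV[R]_d => 2^-1 *: (p.1 + reflection u p.2)).
Proof.
have c1 : continuous (fun p : 'rV[R]_d * 'rV[R]_d => p.1 + reflection u p.2).
  move=> p; apply: continuousD; first exact: cvg_fst.
  apply: (@continuous_comp _ _ _ snd (reflection u)); first exact: cvg_snd.
  exact: reflection_continuous.
move=> p; exact: (continuousZ (@cst_continuous _ _ (2^-1 : R) p) (c1 p)).
Qed.

Lemma compact_minkowski_sym u A : compact A -> compact (minkowski_sym u A).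
Proof.
move=> cA; rewrite (_ : minkowski_sym u A =
    (fun p : 'rV[R]_d * 'rV[R]_d => 2^-1 *: (p.1 + reflection u p.2)) @` (A `*` A)); last first.
  apply/seteqP; split => [_ [_ [a Aa [_ [b Ab <-] <-]] <-]|_ [[a b] [/= Aa Ab] <-]].
    by exists (a, b).
  by exists (a + reflection u b) => //; exists a => //; exists (reflection u b) => //; exists b.
apply: continuous_compact; last exact: compact_setX.
exact/continuous_subspaceT/mid_reflection_continuous.
Qed.

Lemma is_convex_minkowski_sym u A : is_convex A -> is_convex (minkowski_sym u A).
Proof.
move=> cA _ _ t t01 [_ [a Aa [_ [b Ab <-] <-]] <-] [_ [a' Aa' [_ [b' Ab' <-] <-]] <-].
exists (t *: a + (1 - t) *: a' + reflection u (t *: b + (1 - t) *: b')).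
  exists (t *: a + (1 - t) *: a'); first exact: cA.
  by exists (reflection u (t *: b + (1 - t) *: b')) => //; exists (t *: b + (1 - t) *: b') => //; exact: cA.
by rewrite reflectionD !reflectionZ; apply/rowP => i; rewrite !mxE; ring.
Qed.

(* The Steiner symmetral of a compact convex set ([steiner_pairsE]), in a form
   where monotonicity, convexity, compactness and the inclusion in the Minkowski
   symmetral are immediate: both entries of a pair lie on the same chord. *)
Definition steiner_pairs u A : set 'rV[R]_d :=
  [set 2^-1 *: (p.1 + reflection u p.2) |
    p in [set p : 'rV[R]_d * 'rV[R]_d | A p.1 /\ A p.2 /\ proj_orth u p.1 = proj_orth u p.2]].

Lemma chord_line u A x t : sphere u -> chord u A (x + t *: u) = chord u A x.
Proof. by move=> uu; rewrite /chord proj_orth_line. Qed.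

Lemma chord_mid_line u A x t : sphere u -> chord_mid u A (x + t *: u) = chord_mid u A x.
Proof. by move=> uu; rewrite /chord_mid chord_line. Qed.

Lemma line_continuous u x : continuous (fun t : R => x + t *: u).
Proof.
move=> t; apply: (@continuousD _ _ _ (fun=> x) (fun t => t *: u)); first exact: cst_continuous.
by apply: (@continuousZ _ _ _ id (fun=> u)) => //; exact: cst_continuous.
Qed.

(** A nonempty chord is a compact interval, so [inf] and [sup] are its endpoints [a] and [b], and
    the mirror image [a + b - t] stays between them. *)
Lemma chord_mid_sym u A x t : sphere u -> compact A -> is_convex A ->
  chord u A x t -> chord u A x (2 * chord_mid u A x - t).
Proof.
move=> uu cA cvA xt; set I := chord u A x.
have I0 : I !=set0 by exists t.
have clI : closed I.
  apply: (@preimage_closed _ _ (fun t : R => proj_orth u x + t *: u) A).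
    by move=> s _; exact: line_continuous.
  by apply: compact_closed => //; exact: norm_hausdorff.
have [K K0 hK] := compact_enorm_le cA.
have IK s : I s -> `|s| <= K.
  move=> Is; rewrite -[s](@dotv_line u x) //; apply: le_trans (hK _ Is).
  rewrite ler_norml; have := dotv_le_enorm (proj_orth u x + s *: u) u.
  have := dotv_le_enorm (proj_orth u x + s *: u) (- u).
  by rewrite enormN dotvNr uu mulr1; lra.
have cI : compact I.
  apply: (subclosed_compact clI (@segment_compact _ (- K) K)) => s /IK.
  by rewrite /= in_itv /= ler_norml.
have [a /set_mem Ia amin] : exists2 a, a \in I & forall s, s \in I -> a <= s.
  by apply: (@compact_EVT_min _ _ id) => //; apply: continuous_subspaceT => s.
have [b /set_mem Ib bmax] : exists2 b, b \in I & forall s, s \in I -> s <= b.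
  by apply: (@compact_EVT_max _ _ id) => //; apply: continuous_subspaceT => s.
have infI : inf I = a.
  apply/le_anti/andP; split.
    by apply: ge_inf => //; exists a => s Is; apply: amin; rewrite inE.
  by apply: lb_le_inf => // s Is; apply: amin; rewrite inE.
have supI : sup I = b.
  apply/le_anti/andP; split.
    by apply: ge_sup => // s Is; apply: bmax; rewrite inE.
  by apply: ub_le_sup => //; exists b => s Is; apply: bmax; rewrite inE.
have at_ : a <= t by apply: amin; rewrite inE.
have tb : t <= b by apply: bmax; rewrite inE.
rewrite /chord_mid -/I infI supI mulrA divff ?mul1r //.
have [ab|ab] := eqVneq a b.
  by rewrite (_ : a + b - t = t) //; lra.
have ab0 : 0 < b - a by rewrite subr_gt0 lt_neqAle ab (le_trans at_).
(* Here [t = (1 - s) * a + s * b]; exchanging the two weights gives [a + b - t]. *)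
pose s := (t - a) / (b - a).
have s01 : 0 <= s <= 1.
  by rewrite divr_ge0 ?subr_ge0 ?(ltW ab0) ?ler_pdivrMr ?mul1r //; lra.
have es : s * (b - a) = t - a by rewrite divfK // gt_eqF.
rewrite (_ : a + b - t = s * a + (1 - s) * b); last by lra.
have := cvA _ _ s s01 Ia Ib; rewrite /I /chord /=; congr A.
by apply/rowP => i; rewrite !mxE; ring.
Qed.

Lemma steiner_pairsE u A : sphere u -> compact A -> is_convex A ->
  steiner u A = steiner_pairs u A.
Proof.
move=> uu cA cvA; apply/seteqP; split => [_ [x Ax <-]|_ [[a b] [/= Aa [Ab ab]] <-]].
  set m := chord_mid u A x.
  have : chord u A x (dotv x u) by rewrite /chord /= proj_orth_cancel.
  move=> /(chord_mid_sym uu cA cvA); rewrite -/m => Ab.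
  (* [x] is paired with its mirror image in its own chord. *)
  exists (x, proj_orth u x + (2 * m - dotv x u) *: u).
    by split => //; split => //=; rewrite proj_orth_line // proj_orthK.
  rewrite /= /reflection dotv_line //.
  by apply/rowP => i; rewrite /proj_orth !mxE; field.
set m := chord_mid u A a.
have : chord u A a (dotv b u) by rewrite /chord /= ab proj_orth_cancel.
move=> /(chord_mid_sym uu cA cvA); rewrite -/m => Ab'.
(* This is the midpoint of [a] and of the mirror image of [b] in their common chord, whose
   coordinate is [2 * m - dotv b u]; convexity puts it in [A]. *)
exists (a + (m - 2^-1 * (dotv a u + dotv b u) + dotv b u - dotv b u) *: u); last first.
  rewrite chord_mid_line // -/m /reflection -[b in RHS](proj_orth_cancel u) -ab.
  rewrite dotv_line //.
  by apply/rowP => i; rewrite /proj_orth !mxE; field.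
have := is_convex_mid cvA Aa Ab'; congr A.
by apply/rowP => i; rewrite /proj_orth !mxE; field.
Qed.

Lemma steiner_pairs_sub_minkowski_sym u A : steiner_pairs u A `<=` minkowski_sym u A.
Proof.
move=> _ [[a b] [/= Aa [Ab ab]] <-]; exists (a + reflection u b) => //.
by exists a => //; exists (reflection u b) => //; exists b.
Qed.

Lemma is_convex_steiner_pairs u A : is_convex A -> is_convex (steiner_pairs u A).
Proof.
move=> cA _ _ t t01 [[a b] [/= Aa [Ab ab]] <-] [[a' b'] [/= Aa' [Ab' ab']] <-].
exists (t *: a + (1 - t) *: a', t *: b + (1 - t) *: b').
  split; first exact: cA; split; first exact: cA.
  have lin x y : proj_orth u (t *: x + (1 - t) *: y) = t *: proj_orth u x + (1 - t) *: proj_orth u y.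
    by apply/rowP => i; rewrite /proj_orth !dotvE !mxE; ring.
  by rewrite /= !lin ab ab'.
by rewrite /= reflectionD !reflectionZ; apply/rowP => i; rewrite !mxE; ring.
Qed.

Lemma compact_steiner_pairs u A : compact A -> compact (steiner_pairs u A).
Proof.
move=> cA; apply: continuous_compact.
  exact/continuous_subspaceT/mid_reflection_continuous.
have proj_continuous : continuous (proj_orth u).
  move=> x; apply: (@continuousB _ _ _ id (fun x => dotv x u *: u)); first by [].
  apply: (@continuousZ _ _ _ (fun x => dotv x u) (fun=> u)); last exact: cst_continuous.
  exact: dotvl_continuous.
apply: (@subclosed_compact _ _ (A `*` A)); [|exact: compact_setX|by move=> p []; move=> ? []].
rewrite (_ : [set p | _] = (A `*` A) `&` (fun p : 'rV[R]_d * 'rV[R]_d =>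
    enorm (proj_orth u p.1 - proj_orth u p.2)) @^-1` [set 0]); last first.
  apply/seteqP; split => [p [Aa [Ab ab]]|p [[Aa Ab] /enorm_eq0 ab]]; split => //=.
    by rewrite ab subrr /enorm dot0v sqrtr0.
  by split => //; apply/eqP; rewrite -subr_eq0; exact/eqP.
apply: closedI.
  by apply: compact_closed; [exact: norm_hausdorff|exact: compact_setX].
apply: preimage_closed; last exact: closed_eq.
move=> p _; apply: (@continuous_comp _ _ _ (fun p => proj_orth u p.1 - proj_orth u p.2) (@enorm R d)).
  apply: (@continuousB _ _ _ (fun p => proj_orth u p.1) (fun p => proj_orth u p.2)).
    by apply: (@continuous_comp _ _ _ fst (proj_orth u)); [exact: cvg_fst|exact: proj_continuous].
  by apply: (@continuous_comp _ _ _ snd (proj_orth u)); [exact: cvg_snd|exact: proj_continuous].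
exact: enorm_continuous.
Qed.

(** A ball is its own symmetral: [x] arises from the pair of [x] and its reflection. Nonnegative
    lower bounds of the support function persist through this inclusion. *)
Lemma cball_sub_steiner_pairs u A r : sphere u -> cball r `<=` A -> cball r `<=` steiner_pairs u A.
Proof.
move=> uu h x xr; exists (x, reflection u x) => /=.
  by split; [exact: h|split; [apply: h; rewrite /cball /= enorm_reflection|rewrite proj_orth_reflection]].
by rewrite /= reflectionK //; apply/rowP => i; rewrite !mxE; field.
Qed.

Lemma steiner_pairs_nonempty u A : A !=set0 -> steiner_pairs u A !=set0.
Proof. by move=> [a Aa]; exists (2^-1 *: (a + reflection u a)), (a, a). Qed.

Lemma minkowski_sym_nonempty u A : A !=set0 -> minkowski_sym u A !=set0.
Proof.
move=> /(steiner_pairs_nonempty u)[a Aa].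
by exists a; exact: steiner_pairs_sub_minkowski_sym.
Qed.

End Symmetrizations.

(** * Averaging over blocks of reflections *)

Section Contraction.
Variables (R : realType) (d : nat).
Implicit Types (x y th u v : 'rV[R]_d) (r M K e delta : R) (t : nat -> 'rV[R]_d).

(* From index 1 on, runs through 0; 0, 1; 0, ..., 3; 0, ..., 7; and so on, hence
   [block_indexP]. *)
Definition block_index n : nat := n - 2 ^ trunc_log 2 n.

(** The block starts at [2 ^ p] with [p = maxn N k]: this exceeds [k], and the block stays below
    [2 ^ p.+1] because [N < 2 ^ p]. *)
Lemma block_indexP N k : exists2 m, (k <= m)%N & forall i, (i <= N)%N -> block_index (m + i) = i.
Proof.
exists (2 ^ maxn N k)%N.
  by apply: (leq_trans (leq_maxr N k)); rewrite ltnW // ltn_expl.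
move=> i iN; rewrite /block_index (_ : trunc_log 2 _ = maxn N k) ?addKn //.
apply: trunc_log_eq => //; rewrite leq_addr /= expnS mul2n -addnn ltn_add2l.
by apply: (leq_ltn_trans iN); apply: (leq_ltn_trans (leq_maxl N k)); rewrite ltn_expl.
Qed.

(** Compactness in its near-covering form, along [\oo] in [N]: near each [x] one index [i] serves
    all points within [e / 2], and it remains available as [N] grows. *)
Lemma sphere_net t e : 0 < e -> @sphere R d `<=` closure (range t) ->
  exists N, forall x, sphere x -> exists2 i, (i <= N)%N & enorm (x - t i) < e.
Proof.
move=> e0 dense.
have cS := (compact_near_coveringP (@sphere R d)).1 (@compact_sphere R d).
have [|N _ h] := cS nat \oo (fun N x => exists2 i, (i <= N)%N & enorm (x - t i) < e) _.
  move=> x sx; have [_ [[i _ <-]]] := dense x sx _ (near_enorm_lt x (divr_gt0 e0 (ltr0n _ 2))).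
  move=> xi; exists ([set y | enorm (y - x) < e / 2], [set N | (i <= N)%N]) => /=.
    by split; [apply: near_enorm_lt; rewrite divr_gt0|exists i].
  move=> [y N] [/= xy iN]; exists i => //.
  rewrite -(subrK x y) -addrA; apply: (le_lt_trans (ler_enormD _ _)).
  by rewrite (splitr e) ltrD // enormB.
by exists N => x sx; apply: (h N) => //=.
Qed.

(** Two vectors of equal norm are exchanged by the reflection in their bisecting hyperplane; the
    computation rests on [enorm (th - th') ^+ 2 = 2 * (1 - dotv th th')]. *)
Lemma reflection_normalizeB th th' : sphere th -> sphere th' -> th != th' ->
  reflection ((enorm (th - th'))^-1 *: (th - th')) th = th'.
Proof.
move=> /enorm_unit s /enorm_unit s' ne.
have : enorm (th - th') != 0 by rewrite gt_eqF // enorm_gt0 // subr_eq0.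
have := sqr_enorm (th - th'); set n := enorm _.
rewrite !dotvE s s' (dotvC th' th) => e n0.
rewrite /reflection !dotvE s.
have e' : 2 * (n^-1 * (1 - dotv th th')) * n^-1 = 1.
  by rewrite (_ : 1 - _ = n ^+ 2 / 2); [field|rewrite e; field].
by rewrite scalerA e' scale1r opprB addrC subrK.
Qed.

(** The difference splits into two terms, each of norm at most [2 * enorm (u - v)]. *)
Lemma reflection_lipschitz u v x : sphere u -> sphere v -> sphere x ->
  enorm (reflection u x - reflection v x) <= 4 * enorm (u - v).
Proof.
move=> su sv sx.
have -> : reflection u x - reflection v x =
    (2 * dotv x u) *: (v - u) + (2 * dotv x (v - u)) *: v.
  by rewrite /reflection; apply/rowP => i; rewrite !dotvE !mxE; ring.
have dle z : `|dotv x z| <= enorm z.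
  have := dotv_le_enorm x z; have := dotv_le_enorm x (- z).
  by rewrite sx dotvNr enormN !mul1r ler_norml; lra.
apply: (le_trans (ler_enormD _ _)); rewrite !enormZ sv mulr1 !normrM (enormB v).
have := dle u; have := dle (v - u); rewrite su (enormB v) normr_nat.
by have := enorm_ge0 (u - v); have := normr_ge0 (dotv x u); nra.
Qed.

(** * Functions dominated by their averages under successive reflections *)

Section Averaging.
Variables (u : nat -> 'rV[R]_d) (F : nat -> 'rV[R]_d -> R).
Hypothesis su : forall n, sphere (u n).
Hypothesis F_step : forall n th, sphere th ->
  F n.+1 th <= 2^-1 * (F n th + F n (reflection (u n) th)).

Lemma averaging_le n j M : (forall th, sphere th -> F n th <= M) ->
  forall th, sphere th -> F (n + j)%N th <= M.
Proof.
move=> h; elim: j => [|j IH] th sth; first by rewrite addn0 h.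
rewrite addnS; apply: (le_trans (F_step _ sth)).
have := IH _ sth; have := IH _ (sphere_reflection (su (n + j)) sth); lra.
Qed.

(** Each step averages the gap below [M] with another nonnegative gap, hence at worst halves it. *)
Lemma averaging_gap n j M : (forall th, sphere th -> F n th <= M) ->
  forall th, sphere th -> 2^-1 ^+ j * (M - F n th) <= M - F (n + j)%N th.
Proof.
move=> h; elim: j => [|j IH] th sth; first by rewrite addn0 expr0 mul1r.
have := F_step (n + j) sth; have := IH _ sth.
have := averaging_le j h (sphere_reflection (su (n + j)) sth).
by rewrite addnS exprS -mulrA; lra.
Qed.

(** Step [n + i] averages in the gap at the reflected direction, of which at least the fraction
    [2^-1 ^+ i] is left by then; that step and each later one cost at most a further factor 2. *)
Lemma averaging_gap_reflection n j i M : (i < j)%N -> (forall th, sphere th -> F n th <= M) ->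
  forall th, sphere th ->
    2^-1 ^+ j * (M - F n (reflection (u (n + i)) th)) <= M - F (n + j)%N th.
Proof.
move=> + h; elim: j => // j IH; rewrite ltnS leq_eqVlt => /orP[/eqP ->|ij] th sth;
  have := F_step (n + j) sth; rewrite addnS exprS -mulrA.
  have := averaging_gap j h (sphere_reflection (su (n + j)) sth).
  by have := averaging_le j h sth; lra.
have := IH ij _ sth.
by have := averaging_le j h (sphere_reflection (su (n + j)) sth); lra.
Qed.

Variables (t : nat -> 'rV[R]_d) (K : R).
Hypothesis t_sphere : forall n, sphere (t n).
Hypothesis t_dense : @sphere R d `<=` closure (range t).
Hypothesis u_block : forall N k, exists2 m, (k <= m)%N &
  forall i, (i <= N)%N -> u (m + i)%N = t i.
Hypothesis F_lipschitz : forall n th th', sphere th -> sphere th' ->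
  F n th <= F n th' + K * enorm (th - th').
Hypothesis F_lower : forall n th, sphere th -> - K <= F n th.
Hypothesis K0 : 0 <= K.

(* With [h = M - F m], a block of length [N.+1] starting at [m] leaves a gap of at
   least [2^-1 ^+ N.+1 * h (reflection (t i) th)] at [th], for every [i <= N]. *)
Lemma averaging_oscillation M0 delta : 0 < delta ->
  (forall th, sphere th -> F 0 th <= M0) ->
  exists n M, forall th, sphere th -> M - delta <= F n th <= M.
Proof.
move=> delta0 hM0; apply: contrapT => /forallNP H.
have large n M : (forall th, sphere th -> F n th <= M) ->
    exists2 th, sphere th & F n th < M - delta.
  move=> h; apply: contrapT => N; apply: (H n); exists M => th sth.
  rewrite h // andbT leNgt; apply/negP => lt; apply: N; by exists th.
(* Reflecting in [t i] instead of the exact direction moves the image by at most [4 * e], hence [F]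
   by at most [K * (4 * e)], to be kept below [delta / 2]. The [+ 1] avoids dividing by 0. *)
pose e := delta / (8 * (K + 1)).
have K1 : 0 < 8 * (K + 1) by rewrite mulr_gt0 // ltr_wpDl.
have e0 : 0 < e by rewrite divr_gt0.
have Ke : K * (4 * e) <= delta / 2.
  have : e * (8 * (K + 1)) = delta by rewrite divfK // gt_eqF.
  by nra.
have [N hN] := sphere_net e0 t_dense.
pose c := 2^-1 ^+ N.+1 * (delta / 2).
have c0 : 0 < c by rewrite mulr_gt0 ?divr_gt0 // exprn_gt0.
have step j : exists n, forall th, sphere th -> F n th <= M0 - j%:R * c.
  elim: j => [|j [n hn]]; first by exists 0%N => th sth; rewrite mul0r subr0 hM0.
  set M := _ - _ in hn.
  have [m nm hm] := u_block N n.
  have {}hn th : sphere th -> F m th <= M.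
    by move=> sth; rewrite -(subnKC nm); apply: averaging_le.
  exists (m + N.+1)%N => th sth.
  rewrite -natr1 mulrDl mul1r opprD addrA -/M lerBrDr addrC -lerBrDr.
  (* Unless [th] is [th0], a reflection sends [th] to this low direction; some [t i] approximates it
     and loses only half of [delta]. *)
  have [th0 sth0 lt0] := large _ _ hn.
  have gap (y : R) : 2^-1 ^+ N.+1 * (M - y) <= M - F (m + N.+1)%N th -> y <= M - delta / 2 ->
      c <= M - F (m + N.+1)%N th.
    move=> h1 h2; apply: le_trans h1; rewrite ler_pM2l ?exprn_gt0 //; lra.
  have [E|ne] := eqVneq th th0.
    by apply: (gap (F m th)); [exact: averaging_gap|rewrite E; lra].
  have sv := sphere_normalize (_ : th - th0 != 0); rewrite subr_eq0 in sv.
  have [i iN lti] := hN _ (sv ne).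
  apply: (gap (F m (reflection (u (m + i)) th))); first exact: averaging_gap_reflection.
  rewrite hm //; apply: (le_trans (F_lipschitz _ _ sth0)); first exact: sphere_reflection.
  have := reflection_lipschitz (t_sphere i) (sv ne) sth.
  rewrite reflection_normalizeB // (enormB (t i)) => h4.
  have : K * enorm (reflection (t i) th - th0) <= K * (4 * e) by rewrite ler_wpM2l //; lra.
  lra.
have [th sth _] := large _ _ hM0.
(* After this many blocks the upper bound would fall below [- K], against [F_lower]. *)
have [j hj] : exists j : nat, M0 + K < j%:R * c.
  exists (Num.trunc ((`|M0 + K|) / c)).+1.
  rewrite -ltr_pdivrMr //; apply: le_lt_trans (truncnS_gt _).
  by rewrite ler_pM2r ?invr_gt0 // ler_norm.
have [n hn] := step j; have := hn _ sth; have := F_lower n sth; lra.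
Qed.

End Averaging.
End Contraction.

(** * Volume *)

Section Affine_change_of_variable.
Variable R : realType.
Local Notation lambda := (@lebesgue_measure R).

Lemma measurable_affine (a c : R) : measurable_fun setT (fun t : R => a * t + c).
Proof. by apply: measurable_funD => //; exact: measurable_funM. Qed.

(** Both sides are measures in [X]; they agree on half-open intervals, which determines Lebesgue
    measure. *)
Lemma lebesgue_measure_affine (a c : R) (X : set R) : 0 < a -> measurable X ->
  (lambda X = a%:E * lambda ((fun t : R => (a * t + c)%R) @^-1` X))%E.
Proof.
move=> a0; pose phi : measurableTypeR R -> measurableTypeR R := fun t : R => a * t + c.
have mphi : measurable_fun setT phi by exact: measurable_affine.
unshelve epose (pf := pushforward lambda phi :
  {measure set (measurableTypeR R) -> \bar R}); first exact: mphi.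
pose nu := mscale (NngNum (ltW a0)) pf.
move: X; apply: (@lebesgue_measure_unique R nu) => _ [[x y] _ <-] /=.
rewrite /nu /mscale /= /pushforward /=.
rewrite (_ : phi @^-1` _ = `](x - c) / a, (y - c) / a]%classic); last first.
  by apply/seteqP; split => t; rewrite /= !in_itv /= ltr_pdivrMr // ler_pdivlMr // ltrBlDr lerBrDr (mulrC t).
rewrite !lebesgue_measure_itv /= !lte_fin ltr_pM2r ?invr_gt0 // ltrD2r.
case: ifP => _; last by rewrite mule0.
by rewrite -!EFinB -EFinM; congr EFin; field; rewrite gt_eqF.
Qed.

Lemma ge0_integral_affine (a c : R) (g : R -> \bar R) : 0 < a -> measurable_fun setT g ->
  (forall t, 0 <= g t)%E ->
  (\int[lambda]_t g t = a%:E * \int[lambda]_t g (a * t + c)%R)%E.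
Proof.
move=> a0 mg g0; pose phi : measurableTypeR R -> measurableTypeR R := fun t : R => a * t + c.
have mphi : measurable_fun setT phi by exact: measurable_affine.
unshelve epose (pf := pushforward lambda phi :
  {measure set (measurableTypeR R) -> \bar R}); first exact: mphi.
pose nu := mscale (NngNum (ltW a0)) pf.
transitivity (\int[nu]_t g t)%E.
  by apply: eq_measure_integral => X mX _; exact: (lebesgue_measure_affine c a0 mX).
rewrite ge0_integral_mscale //= ge0_integral_pushforward //.
Qed.

End Affine_change_of_variable.

(** * Borel sets and measurable maps of row vectors *)

Section Borel_sets.
Variables (R : realType) (n : nat).
Implicit Types (x y : 'rV[R]_n) (r : R).

Definition cube x r : set 'rV[R]_n := [set y | forall i, `|y ord0 i - x ord0 i| < r].

Lemma measurable_open_rV (U : set (borel_rV R n)) : open (U : set 'rV[R]_n) -> measurable U.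
Proof. exact: sub_sigma_algebra. Qed.

Lemma measurable_closed_rV (U : set (borel_rV R n)) : closed (U : set 'rV[R]_n) -> measurable U.
Proof.
move=> cU; have oU : open (~` U : set 'rV[R]_n) by exact: closed_openC.
by rewrite -(setCK U); apply: measurableC; exact: measurable_open_rV.
Qed.

Lemma measurable_compact_rV (U : set (borel_rV R n)) : compact (U : set 'rV[R]_n) -> measurable U.
Proof.
by move=> cU; apply: measurable_closed_rV; apply: compact_closed; [exact: norm_hausdorff|].
Qed.

Lemma continuous_measurable_rV (f : 'rV[R]_n -> R) : continuous f ->
  measurable_fun setT (f : borel_rV R n -> R).
Proof.
move=> /continuousP cf; apply: (measurability _ (RGenOpens.measurableE R)).
move=> _ [_ [a [b ->] <-]]; rewrite setTI; apply: measurable_open_rV.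
exact/cf/interval_open.
Qed.

Lemma continuous_measurable_fun_rV (m : nat) (f : 'rV[R]_n -> 'rV[R]_m) : continuous f ->
  measurable_fun setT (f : borel_rV R n -> borel_rV R m).
Proof.
move=> /continuousP cf; apply: (@measurability _ _ (borel_rV R n) (borel_rV R m) setT f (@open 'rV[R]_m)) => //.
by move=> _ [U oU <-]; rewrite setTI; apply: measurable_open_rV; exact: cf.
Qed.

(** Rational centres and inverse integer radii make the union countable. A radius below [e / 2]
    suffices around [x], as two points of a cube differ by less than twice its radius in each
    coordinate. *)
Lemma open_bigcup_cubes (U : set 'rV[R]_n) : open U ->
  U = \bigcup_(p : 'rV[rat]_n * nat)
    (if `[< cube (map_mx ratr p.1) p.2.+1%:R^-1 `<=` U >]
     then cube (map_mx ratr p.1) p.2.+1%:R^-1 else set0).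
Proof.
move=> oU; apply/seteqP; split => [x Ux|x [[q k] _] /=]; last by case: ifPn => // /asboolP; apply.
have /nbhs_ballP[e /= e0 xeU] : nbhs x U by exact: open_nbhs_nbhs.
have [k _ /(_ _ (leqnn k)) ke] := near_infty_natSinv_lt (PosNum (divr_gt0 e0 (ltr0n R 2))).
rewrite /= in ke; set r := k.+1%:R^-1 in ke.
have r0 : 0 < r by rewrite invr_gt0.
have /choice[q hq] (i : 'I_n) : exists q : rat, ratr q \in `]x ord0 i - r, x ord0 i + r[.
  by apply: rat_in_itvoo; lra.
have xq : cube (map_mx ratr (\row_i q i)) r x.
  by move=> i; rewrite !mxE; have := hq i; rewrite in_itv /= ltr_norml => /andP[]; lra.
exists (\row_i q i, k) => //=; rewrite -/r asboolT // => y yq.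
apply: xeU; split => // i j; rewrite (ord1 i).
change (`|x ord0 j - y ord0 j| < e).
have := xq j; have := yq j; rewrite !ltr_norml => /andP[? ?] /andP[? ?].
by apply/andP; split; lra.
Qed.

(** An open set is a countable union of cubes, and the preimage of a cube is a finite intersection
    of coordinate preimages. *)
Lemma measurable_fun_to_rV d (T : measurableType d) (f : T -> borel_rV R n) :
  (forall i, measurable_fun setT (fun z => (f z : 'rV[R]_n) ord0 i : R)) -> measurable_fun setT f.
Proof.
move=> mf; apply: (@measurability _ _ T (borel_rV R n) setT f (@open 'rV[R]_n)) => //.
move=> _ [U oU <-]; rewrite setTI (open_bigcup_cubes oU) preimage_bigcup.
apply: countable_bigcupT_measurable => [|[q k]]; first exact: countableP.
case: ifP => _; last by rewrite preimage_set0.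
rewrite (_ : _ @^-1` _ = \bigcap_(i in [set: 'I_n])
    ((fun z => (f z : 'rV[R]_n) ord0 i) @^-1` ball (ratr (q ord0 i) : R) k.+1%:R^-1)).
  apply: fin_bigcap_measurable => // i _.
  rewrite -[X in measurable X]setTI; apply: (mf i) => //; exact: measurable_ball.
apply/seteqP; split => x /=.
  by move=> h i _; have := h i; rewrite /= !mxE /ball_ /= distrC.
by move=> h i; have := h i Logic.I; rewrite /= !mxE /ball_ /= distrC.
Qed.

End Borel_sets.

(** * Splitting off the first coordinate *)

Section Row_cons.
Variables (R : realType) (n : nat).
Implicit Types (y : 'rV[R]_n) (t a : R).

(** The block row appearing in [volume], with [1 + n] retyped as [n.+1]. *)
Definition row_cons t y : 'rV[R]_n.+1 := (row_mx t%:M y : 'rV[R]_(1 + n)).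

Lemma row_cons0 t y : row_cons t y ord0 ord0 = t.
Proof.
transitivity (row_mx t%:M y ord0 (lshift n ord0)); last by rewrite row_mxEl mxE eqxx mulr1n.
by congr (fun_of_matrix _ _ _); exact: val_inj.
Qed.

Lemma row_consS t y (i : 'I_n) : row_cons t y ord0 (rshift 1 i : 'I_(1 + n)) = y ord0 i.
Proof. exact: row_mxEr. Qed.

Lemma ord_row_consP (P : 'I_n.+1 -> Prop) :
  P ord0 -> (forall i : 'I_n, P (rshift 1 i : 'I_(1 + n))) -> forall i, P i.
Proof.
move=> P0 PS i; case: (@split_ordP 1 n i) => j ->; last exact: PS.
by rewrite (ord1 j); congr P: P0; exact: val_inj.
Qed.

Lemma row_consD t t' y y' : row_cons t y + row_cons t' y' = row_cons (t + t') (y + y').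
Proof.
apply/rowP => i; rewrite [in LHS]mxE; move: i; apply: ord_row_consP => [|i].
  by rewrite !row_cons0.
by rewrite !row_consS mxE.
Qed.

Lemma row_consZ a t y : a *: row_cons t y = row_cons (a * t) (a *: y).
Proof.
apply/rowP => i; rewrite [in LHS]mxE; move: i; apply: ord_row_consP => [|i].
  by rewrite !row_cons0.
by rewrite !row_consS mxE.
Qed.

Lemma row_consE (x : 'rV[R]_n.+1) :
  x = row_cons (x ord0 ord0) (@rsubmx R 1 1 n x).
Proof.
apply/rowP; apply: ord_row_consP => [|i]; first by rewrite row_cons0.
by rewrite row_consS mxE.
Qed.

Lemma row_consK t y : @rsubmx R 1 1 n (row_cons t y) = y.
Proof. exact: row_mxKr. Qed.

Lemma dotv_row_cons t t' y y' :
  dotv (row_cons t y) (row_cons t' y') = t * t' + dotv y y'.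
Proof.
rewrite /dotv big_ord_recl !row_cons0; congr (_ + _); apply: eq_bigr => i _.
have -> : lift ord0 i = (rshift 1 i : 'I_(1 + n)) :> 'I_n.+1 by exact: val_inj.
by rewrite !row_consS.
Qed.

Lemma measurable_row_cons :
  measurable_fun setT (fun p : R * borel_rV R n => row_cons p.1 p.2 : borel_rV R n.+1).
Proof.
apply: measurable_fun_to_rV; apply: ord_row_consP => [|i].
  by under eq_fun do rewrite row_cons0; exact: measurable_fst.
under eq_fun do rewrite row_consS.
have : measurable_fun setT ((fun y : 'rV[R]_n => y ord0 i) : borel_rV R n -> R).
  by apply: continuous_measurable_rV => x; exact: coord_continuous.
by move=> /measurableT_comp; apply; exact: measurable_snd.
Qed.

End Row_cons.

Definition row_section (R : realType) n (E : set 'rV[R]_n.+1) (t : R) : set 'rV[R]_n :=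
  [set y | E (row_cons t y)].

(** * The iterated integral as a Borel measure *)

Section Volume.
Variable R : realType.
Local Notation lambda := (@lebesgue_measure R).

Lemma volumeS n (E : set 'rV[R]_n.+1) :
  volume E = (\int[lambda]_t volume (row_section E t))%E.
Proof. by []. Qed.

Lemma volume_ge0 n (E : set 'rV[R]_n) : (0 <= volume E)%E.
Proof. by elim: n E => [|n IH] E /=; [rewrite lee_fin|apply: integral_ge0]. Qed.

Lemma volume0 n : volume (@set0 'rV[R]_n) = 0%E.
Proof.
elim: n => [|n IH]; first by rewrite /= indic0.
by rewrite volumeS; apply: integral0_eq => t _; exact: IH.
Qed.

Lemma row_section_cube n (x : 'rV[R]_n.+1) r t :
  row_section (cube x r) t =
  if `|t - x ord0 ord0| < r then cube (@rsubmx R 1 1 n x) r else set0.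
Proof.
apply/seteqP; split => [y h|y].
  have := h ord0; rewrite row_cons0 => ->.
  by move=> i; have := h (rshift 1 i : 'I_(1 + n)); rewrite row_consS mxE.
case: ifP => // tr h; apply: ord_row_consP => [|i]; first by rewrite row_cons0.
by have := h i; rewrite row_consS mxE.
Qed.

Lemma volume_cube n (x : 'rV[R]_n) r : 0 < r -> volume (cube x r) = ((2 * r) ^+ n)%:E.
Proof.
move=> r0; elim: n x => [|n IH] x.
  by rewrite /= indicE mem_set // => -[].
transitivity (\int[lambda]_t (((2 * r) ^+ n)%:E * (\1_(ball (x ord0 ord0) r : set (measurableTypeR R)) t)%:E))%E.
  rewrite volumeS; apply: eq_integral => t _.
  rewrite row_section_cube indicE; case: ifPn => h.
    by rewrite mem_set ?mule1 ?IH // /ball /= distrC.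
  by rewrite memNset ?mule0 ?volume0 // /ball /= distrC; exact/negP.
rewrite ge0_integralZl //=; last 2 first.
- by apply/measurable_EFinP; apply: measurable_indic; exact: measurable_ball.
- by rewrite lee_fin exprn_ge0 // mulr_ge0 // ltW.
rewrite integral_indic ?setIT //; last exact: measurable_ball.
rewrite [X in (_ * X)%E](_ : _ = lebesgue_measure (ball (x ord0 ord0) r)) //.
by rewrite lebesgue_measure_ball ?(ltW r0) // -EFinM exprSr mulr_natl.
Qed.

Lemma cube_cover n : [set: 'rV[R]_n] = \bigcup_k cube (0 : 'rV[R]_n) k.+1%:R.
Proof.
apply/seteqP; split => // x _; exists (Num.trunc `|x|) => // i.
rewrite mxE subr0; apply: le_lt_trans (truncnS_gt _); exact: coord_le_norm.
Qed.

Lemma measurable_cube n (x : 'rV[R]_n) r : measurable (cube x r : set (borel_rV R n)).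
Proof.
rewrite (_ : cube x r = \bigcap_(i in [set: 'I_n]) ((fun y : 'rV[R]_n => y ord0 i) @^-1` ball (x ord0 i) r)).
  apply: fin_bigcap_measurable => // i _; rewrite -[X in measurable X]setTI.
  apply: (@continuous_measurable_rV R n (fun y => y ord0 i)) => //; last exact: measurable_ball.
  by move=> y; exact: coord_continuous.
apply/seteqP; split => y /=.
  by move=> h i _; have := h i; rewrite /= /ball /= distrC.
by move=> h i; have := h i Logic.I; rewrite /= /ball /= distrC.
Qed.

(** In dimension 0 this is a Dirac mass; in dimension [n.+1] it is the image under [row_cons] of the
    product of [lambda] and [mu]. Cubes of finite volume keep it sigma-finite, as the Fubini
    argument requires. *)
Lemma volume_measure n : exists mu : {sigma_finite_measure set (borel_rV R n) -> \bar R},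
  forall E : set (borel_rV R n), measurable E -> volume E = mu E.
Proof.
elim: n => [|n [mu IH]].
  by exists (\d_ (0 : borel_rV R 0)) => E _.
pose phi : measurableTypeR R * borel_rV R n -> borel_rV R n.+1 := fun p => row_cons p.1 p.2.
unshelve epose (pf := pushforward (lambda \x mu)%E phi :
  {measure set (borel_rV R n.+1) -> \bar R}); first exact: measurable_row_cons.
have pfE (E : set (borel_rV R n.+1)) : measurable E -> volume E = pf E.
  move=> mE; have mF : measurable (phi @^-1` E).
    by rewrite -[X in measurable X]setTI; apply: measurable_row_cons.
  rewrite volumeS; apply: eq_integral => t _ /=; rewrite xsectionE -IH //.
  by rewrite -xsectionE; exact: measurable_xsection.
have sf : sigma_finite setT pf.
  exists (fun k => cube (0 : 'rV[R]_n.+1) k.+1%:R); first exact: cube_cover.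
  move=> k; split; first exact: measurable_cube.
  by rewrite -pfE ?volume_cube ?ltry //; exact: measurable_cube.
pose H := Measure_isSigmaFinite.Build _ _ _ pf sf.
pose nu : {sigma_finite_measure set (borel_rV R n.+1) -> \bar R} := HB.pack (Measure.sort pf) H.
by exists nu.
Qed.

End Volume.

(** * Fubini, affine maps and shears *)

Section Volume_symmetrization.
Variable R : realType.
Local Notation lambda := (@lebesgue_measure R).

Lemma le_volume n (A B : set (borel_rV R n)) : measurable A -> measurable B -> A `<=` B ->
  (volume A <= volume B)%E.
Proof.
move=> mA mB AB; have [mu muE] := volume_measure R n.
by rewrite !muE // le_measure // inE.
Qed.

Lemma measurable_row_cons_preimage n (E : set (borel_rV R n.+1)) : measurable E ->
  measurable ((fun p : measurableTypeR R * borel_rV R n => row_cons p.1 p.2 : borel_rV R n.+1) @^-1` E).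
Proof. by move=> mE; rewrite -[X in measurable X]setTI; apply: measurable_row_cons. Qed.

Lemma measurable_row_section n (E : set (borel_rV R n.+1)) t : measurable E ->
  measurable (row_section E t : set (borel_rV R n)).
Proof.
move=> /measurable_row_cons_preimage/(@measurable_xsection _ _ _ _ _ t).
by rewrite xsectionE.
Qed.

Lemma measurable_volume_row_section n (E : set (borel_rV R n.+1)) : measurable E ->
  measurable_fun setT (fun t : measurableTypeR R => volume (row_section E t)).
Proof.
move=> mE; have [mu muE] := volume_measure R n.
have := measurable_fun_xsection mu (measurable_row_cons_preimage mE).
apply: eq_measurable_fun => t _ /=; rewrite xsectionE -muE //.
exact: measurable_row_section.
Qed.

(** Integrating the first coordinate innermost exposes the lengths of chords parallel to the first
    axis; uniqueness of the product measure allows the exchange. *)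
Lemma volume_fubini n : exists mu : {sigma_finite_measure set (borel_rV R n) -> \bar R},
  forall E : set (borel_rV R n.+1), measurable E ->
    volume E = (\int[mu]_y lambda [set t | E (row_cons t y)])%E.
Proof.
have [mu muE] := volume_measure R n; exists mu => E mE.
have mF := measurable_row_cons_preimage mE.
transitivity ((lambda \x mu)%E ((fun p : measurableTypeR R * borel_rV R n => row_cons p.1 p.2 : borel_rV R n.+1) @^-1` E)).
  rewrite volumeS; apply: eq_integral => t _ /=; rewrite xsectionE -muE //.
  exact: measurable_row_section.
rewrite (@product_measure_unique _ _ _ _ R lambda mu (lambda \x^ mu)%E) //; last first.
  by move=> A B mA mB; exact: product_measure2E.
by apply: eq_integral => y _ /=; rewrite ysectionE.
Qed.

Lemma affine_continuous n (a : R) (v : 'rV[R]_n) : continuous (fun y : 'rV[R]_n => a *: y + v).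
Proof.
move=> y; apply: (@continuousD _ _ _ (fun y => a *: y) (fun=> v)); last exact: cst_continuous.
exact: scaler_continuous.
Qed.

Lemma measurable_affine_preimage n (a : R) (v : 'rV[R]_n) (E : set (borel_rV R n)) : measurable E ->
  measurable ((fun y : 'rV[R]_n => a *: y + v) @^-1` E : set (borel_rV R n)).
Proof.
move=> mE; rewrite -[X in measurable X]setTI.
by apply: (continuous_measurable_fun_rV (@affine_continuous n a v)).
Qed.

(** Each coordinate contributes a factor [a] through the one-dimensional change of variable, since a
    section of the preimage is an affine preimage of a section. *)
Lemma volume_affine n (a : R) (v : 'rV[R]_n) (E : set (borel_rV R n)) : 0 < a -> measurable E ->
  ((a ^+ n)%:E * volume ((fun y : 'rV[R]_n => (a *: y + v)%R) @^-1` E) = volume E)%E.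
Proof.
move=> a0; elim: n v E => [|n IH] v E mE.
  by rewrite expr0 mul1e /= !indicE /=; congr (_ %:E); congr (_ %:R); congr nat_of_bool;
     apply/idP/idP; rewrite !inE /=; congr E; apply/rowP => -[].
have sec t : row_section ((fun y : 'rV[R]_n.+1 => a *: y + v) @^-1` E) t =
    (fun y : 'rV[R]_n => a *: y + @rsubmx R 1 1 n v) @^-1` row_section E (a * t + v ord0 ord0).
  have line y : a *: row_cons t y + v = row_cons (a * t + v ord0 ord0) (a *: y + @rsubmx R 1 1 n v).
    by rewrite {1}[v]row_consE row_consZ row_consD.
  by apply/seteqP; split => y; rewrite /row_section /= line.
rewrite !volumeS exprS EFinM -muleA -ge0_integralZl //=; last 3 first.
- by apply: measurable_volume_row_section; apply: (@measurable_affine_preimage n.+1).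
- by move=> t _; exact: volume_ge0.
- by rewrite lee_fin exprn_ge0 // ltW.
rewrite [RHS](ge0_integral_affine (v ord0 ord0) a0); last 2 first.
- exact: measurable_volume_row_section.
- by move=> t; exact: volume_ge0.
congr (_ * _)%E; apply: eq_integral => t _; rewrite sec IH //.
exact: measurable_row_section.
Qed.

(** It sends lines parallel to the first axis to lines of direction [row_cons 1 v]. *)
Definition shear n (v : 'rV[R]_n) (x : 'rV[R]_n.+1) : 'rV[R]_n.+1 :=
  x + x ord0 ord0 *: row_cons 0 v.

Lemma shear_row_cons n (v : 'rV[R]_n) t y : shear v (row_cons t y) = row_cons t (y + t *: v).
Proof. by rewrite /shear row_cons0 row_consZ row_consD mulr0 addr0. Qed.

Lemma shear_continuous n (v : 'rV[R]_n) : continuous (shear v).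
Proof.
have c : continuous (fun x : 'rV[R]_n.+1 => x ord0 ord0 *: row_cons 0 v).
  move=> x; exact: (continuousZ (@coord_continuous R 1 n.+1 ord0 ord0 x) (@cst_continuous _ _ (row_cons 0 v) x)).
move=> x; apply: (@continuousD _ _ _ id (fun x : 'rV[R]_n.+1 => x ord0 ord0 *: row_cons 0 v)).
  exact: cvg_id.
exact: c.
Qed.

(** Pulling back by the shear only translates the section at [t], by a multiple of [v]. *)
Lemma volume_shear n (v : 'rV[R]_n) (E : set (borel_rV R n.+1)) : measurable E ->
  volume (shear v @^-1` E) = volume E.
Proof.
move=> mE; rewrite !volumeS; apply: eq_integral => t _.
rewrite -[RHS](@volume_affine n 1 (t *: v)) //; last exact: measurable_row_section.
rewrite expr1n mul1e; congr volume; apply/seteqP; split => y;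
by rewrite /row_section /= shear_row_cons scale1r.
Qed.

Lemma is_convex_row_section n (A : set 'rV[R]_n.+1) t : is_convex A -> is_convex (row_section A t).
Proof.
move=> cA x y s s01 Ax Ay; rewrite /row_section /=.
have := cA _ _ s s01 Ax Ay; rewrite !row_consZ row_consD; congr A; congr row_cons.
ring.
Qed.

End Volume_symmetrization.

(** * Steiner symmetrization preserves volume; volumes of bodies and balls *)

Section Steiner_volume.
Variable R : realType.
Local Notation lambda := (@lebesgue_measure R).

Lemma compact_row_section n (A : set 'rV[R]_n.+1) t : compact A -> compact (row_section A t).
Proof.
move=> cA; have clA : closed A by apply: compact_closed => //; exact: norm_hausdorff.
rewrite (_ : row_section A t =
    (@rsubmx R 1 1 n) @` (A `&` (fun x : 'rV[R]_n.+1 => x ord0 ord0) @^-1` [set t])); last first.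
  apply/seteqP; split => [y Ay|_ [x [Ax <-] <-]].
    exists (row_cons t y); last exact: row_consK.
    by split => //; exact: row_cons0.
  by rewrite /row_section /= -row_consE.
apply: continuous_compact; first by apply: continuous_subspaceT => x; exact: (@continuous_rsubmx R 1 1 n x).
apply: subclosed_compact cA _; last exact: subIsetl.
apply: closedI; first exact: clA.
apply: preimage_closed; last exact: closed_eq.
by move=> x _; exact: coord_continuous.
Qed.

(** When the first coordinate of the direction vanishes, every chord lies inside one section, so
    projections and midpoints restrict to sections. *)
Lemma row_section_steiner n (u : 'rV[R]_n) (A : set 'rV[R]_n.+1) t :
  row_section (steiner (row_cons 0 u) A) t = steiner u (row_section A t).
Proof.
have proj y : proj_orth (row_cons 0 u) (row_cons t y) = row_cons t (proj_orth u y).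
  rewrite /proj_orth dotv_row_cons mulr0 add0r -!scaleNr row_consZ row_consD.
  by rewrite mulr0 addr0.
have mid y : chord_mid (row_cons 0 u) A (row_cons t y) = chord_mid u (row_section A t) y.
  rewrite /chord_mid (_ : chord _ _ _ = chord u (row_section A t) y) //.
  apply/seteqP; split => s; by rewrite /chord /row_section /= proj row_consZ row_consD mulr0 addr0.
apply/seteqP; split => [y [x Ax E]|_ [y Ay <-]].
  have [x0 x'E] : x ord0 ord0 = t /\ @rsubmx R 1 1 n x - chord_mid (row_cons 0 u) A x *: u = y.
    move: E; rewrite {1 3}[x]row_consE -scaleNr row_consZ row_consD mulr0 addr0 scaleNr => E; split.
      by have := congr1 (fun z : 'rV[R]_n.+1 => z ord0 ord0) E; rewrite !row_cons0.
    by have := congr1 (@rsubmx R 1 1 n) E; rewrite !row_consK.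
  exists (@rsubmx R 1 1 n x); first by rewrite /row_section /= -x0 -row_consE.
  by rewrite -mid -x0 -row_consE.
exists (row_cons t y) => //.
by rewrite mid -!scaleNr row_consZ row_consD mulr0 addr0.
Qed.

(* If the first coordinate of [u] vanishes, the symmetrization acts on each section.
   Otherwise a shear along [u] makes the chords parallel to the first axis, and each
   of them is translated. *)
Lemma volume_steiner n (u : 'rV[R]_n) (A : set 'rV[R]_n) : sphere u -> compact A -> is_convex A ->
  volume (steiner u A) = volume A.
Proof.
elim: n u A => [|n IH] u A su cA cvA.
  have := enorm_unit su; rewrite /dotv big_ord0 => /esym/eqP.
  by rewrite oner_eq0.
have mA := measurable_compact_rV cA.
have mS : measurable (steiner u A : set (borel_rV R n.+1)).
  by apply: measurable_compact_rV; rewrite steiner_pairsE //; exact: compact_steiner_pairs.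
have uE := row_consE u; set u0 := u ord0 ord0 in uE; set u' := rsubmx _ in uE.
have [u00|u00] := eqVneq u0 0.
  rewrite !volumeS; apply: eq_integral => t _; rewrite uE u00 row_section_steiner IH //.
  - apply: sphere_dotv; have := enorm_unit su.
    by rewrite uE dotv_row_cons u00 mul0r add0r.
  - exact: compact_row_section.
  - exact: is_convex_row_section.
have [mu fub] := volume_fubini R n.
pose v := u0^-1 *: u'.
have msh (E : set (borel_rV R n.+1)) : measurable E -> measurable (shear v @^-1` E : set (borel_rV R n.+1)).
  move=> mE; rewrite -[X in measurable X]setTI.
  by apply: (continuous_measurable_fun_rV (@shear_continuous R n v)).
rewrite -(volume_shear v mS) -(volume_shear v mA) !fub; [|exact: msh|exact: msh].
apply: eq_integral => y _.
have lineE t : shear v (row_cons t y) = row_cons 0 y + (t / u0) *: u.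
  by rewrite shear_row_cons [in RHS]uE row_consZ row_consD add0r divfK // /v scalerA.
set m := chord_mid u A (row_cons 0 y).
(* All points of this line share the midpoint [m], so on it the symmetral is a translate of [A]. *)
have steinerE s : steiner u A (row_cons 0 y + s *: u) <-> A (row_cons 0 y + (s + m) *: u).
  split => [[x Ax E]|Ax].
    have xE : x = row_cons 0 y + (s + chord_mid u A x) *: u.
      by rewrite scalerDl addrA -E subrK.
    have mE : chord_mid u A x = m by rewrite xE chord_mid_line.
    by rewrite -mE -xE.
  exists (row_cons 0 y + (s + m) *: u) => //; rewrite chord_mid_line // -/m.
  by rewrite scalerDl addrA addrK.
have mL : measurable [set t : R | A (shear v (row_cons t y))].
  apply: closed_measurable.
  rewrite (_ : [set t | _] = (fun t => row_cons 0 y + t *: row_cons 1 v) @^-1` A); last first.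
    by apply/seteqP; split => t; rewrite /= shear_row_cons row_consZ row_consD add0r mulr1.
  apply: preimage_closed; first by move=> t _; exact: line_continuous.
  by apply: compact_closed; [exact: norm_hausdorff|].
(* The parameter along [u] is [t / u0], so a shift by [m] along [u] is a shift of [t] by
   [m * u0]. *)
rewrite [RHS](lebesgue_measure_affine (m * u0) (@ltr01 R) mL) mul1e.
congr lambda; apply/seteqP; split => t /=; rewrite !lineE steinerE mul1r mulrDl mulfK //.
Qed.

Lemma compact_cball n (r : R) : compact (@cball R n r).
Proof.
apply: bounded_closed_compact; first by apply: (@enorm_bounded_set _ _ _ r).
apply: (@preimage_closed _ _ (@enorm R n) [set x | x <= r]); last exact: closed_le.
by move=> x _; exact: enorm_continuous.
Qed.

Lemma interior_cball n (r : R) : 0 < r -> interior (@cball R n r) !=set0.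
Proof.
move=> r0; exists 0; apply: filterS (near_enorm_lt 0 r0) => x.
by rewrite subr0 => /ltW.
Qed.

Lemma volume_body n (A : set 'rV[R]_n) : compact A -> interior A !=set0 ->
  (0 < volume A < +oo)%E.
Proof.
move=> cA [x /nbhs_ballP[e /= e0 eA]]; have [K K0 hK] := compact_enorm_le cA.
apply/andP; split.
  apply: (@lt_le_trans _ _ (volume (cube x e))).
    by rewrite volume_cube // lte_fin exprn_gt0 // mulr_gt0.
  apply: le_volume; [exact: measurable_cube|exact: measurable_compact_rV|].
  move=> y xy; apply: eA; split => // i j; rewrite (ord1 i).
  by rewrite /ball /= distrC; exact: xy.
apply: (@le_lt_trans _ _ (volume (cube (0 : 'rV[R]_n) (K + 1)))); last first.
  by rewrite volume_cube ?ltry // ltr_wpDl.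
apply: le_volume; [exact: measurable_compact_rV|exact: measurable_cube|].
move=> y Ay i; rewrite mxE subr0; apply: le_lt_trans (coord_le_enorm y i) _.
by apply: le_lt_trans (hK _ Ay) _; rewrite ltrDl.
Qed.

Lemma volume_cball n (r : R) : 0 < r ->
  volume (@cball R n r) = ((r ^+ n)%:E * volume (@cball R n 1))%E.
Proof.
move=> r0; rewrite -(@volume_affine R n r 0 (cball r)) //; last first.
  by apply: measurable_compact_rV; exact: compact_cball.
have key z : (r * z <= r) = (z <= 1) by rewrite -[X in _ <= X]mulr1 ler_pM2l.
by congr (_ * volume _)%E; apply/seteqP; split => x; rewrite /cball /= addr0 enormZ gtr0_norm // key.
Qed.

Lemma volume_cball_fin n : exists2 v : R, 0 < v & volume (@cball R n 1) = v%:E.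
Proof.
have := volume_body (@compact_cball n 1) (@interior_cball n 1 ltr01).
by case: (volume _) => [v| |] /andP[v0 vy]; [exists v|rewrite ltxx in vy|].
Qed.

Lemma volume_cball_lt n (r s : R) : (0 < n)%N -> 0 < r -> r < s ->
  (volume (@cball R n r) < volume (@cball R n s))%E.
Proof.
move=> n0 r0 rs; rewrite (volume_cball n r0) (volume_cball n (lt_trans r0 rs)).
have [v v0 ->] := volume_cball_fin n.
by rewrite -!EFinM lte_fin ltr_pM2r // ltrXn2r ?(ltW r0) // -lt0n.
Qed.

(** By homogeneity of the volume, the [n]-th root of the ratio of [volume A] to the unit ball's
    volume is a valid radius; hence [xget] does not return its default 0. *)
Lemma volume_radiusP n (A : set 'rV[R]_n) : (0 < n)%N -> compact A -> interior A !=set0 ->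
  0 < volume_radius A /\ volume (@cball R n (volume_radius A)) = volume A.
Proof.
move=> n0 cA iA; suff ex : exists r, 0 < r /\ volume (dilate r (@unit_ball R n)) = volume A.
  have [r0 E] := xgetPex (0 : R) ex; split => //.
  by rewrite -dilate_unit_ball // ltW.
have := volume_body cA iA; have [v v0 vE] := volume_cball_fin n.
case: (volume A) => [a| |] /andP[a0 ay]; [|by rewrite ltxx in ay|by []].
rewrite lte_fin in a0.
have av0 : 0 < a / v by rewrite divr_gt0.
exists ((a / v) `^ n%:R^-1); have r0 : 0 < (a / v) `^ n%:R^-1 by rewrite powR_gt0.
split => //; rewrite dilate_unit_ball ?ltW // volume_cball // vE.
rewrite -powR_mulrn ?ltW // -powRrM mulVf ?pnatr_eq0 -?lt0n //.
by rewrite powRr1 ?ltW // -EFinM divfK // gt_eqF.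
Qed.

End Steiner_volume.

(** * Mean radius *)

Section Mean_radius.
Variables (R : realType) (d : nat) (sigma : probability (borel_rV R d) R).
Hypothesis hsigma : rotation_invariant_on_sphere sigma.
Implicit Types (u th : 'rV[R]_d) (A : set 'rV[R]_d) (f : 'rV[R]_d -> R).

Let sphereB : set (borel_rV R d) := @sphere R d.

Lemma measurable_sphere : measurable (@sphere R d : set (borel_rV R d)).
Proof. by apply: measurable_closed_rV; exact: closed_sphere. Qed.

Lemma reflection_mulmx u th : reflection u th = th *m (1%:M - 2 *: (u^T *m u)).
Proof.
rewrite mulmxBr mulmx1 -scalemxAr mulmxA (_ : th *m u^T = (dotv th u)%:M); last first.
  apply/matrixP => i j; rewrite !mxE (ord1 i) (ord1 j) mulr1n.
  by apply: eq_bigr => k _; rewrite !mxE.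
by rewrite mul_scalar_mx scalerA.
Qed.

(** The matrix is symmetric, and its square is the identity because reflections are involutive. *)
Lemma reflection_orthogonal u : sphere u ->
  (1%:M - 2 *: (u^T *m u)) *m (1%:M - 2 *: (u^T *m u))^T = 1%:M :> 'M[R]_d.
Proof.
move=> su; set O := 1%:M - _.
have -> : O^T = O.
  apply/matrixP => i j; rewrite !mxE eq_sym; congr (_ - 2 * _).
  by apply: eq_bigr => k _; rewrite !mxE mulrC.
apply/row_matrixP => i; rewrite !rowE mulmx1 mulmxA /O -!reflection_mulmx.
exact: reflectionK.
Qed.

Lemma measurable_reflection u :
  measurable_fun setT (reflection u : borel_rV R d -> borel_rV R d).
Proof. by apply: continuous_measurable_fun_rV; exact: reflection_continuous. Qed.

Lemma sphere_integrable f M : continuous f -> (forall th, sphere th -> `|f th| <= M) ->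
  sigma.-integrable sphereB (EFin \o f).
Proof.
move=> cf hM; apply: measurable_bounded_integrable; first exact: measurable_sphere.
- by rewrite (le_lt_trans (probability_le1 _ _)) ?ltry //; exact: measurable_sphere.
- by apply: measurable_funTS; exact: continuous_measurable_rV.
- exists M; split; first exact: num_real.
  by move=> K MK x sx; apply: le_trans (ltW MK); exact: hM.
Qed.

Lemma support_fun_continuous A : A !=set0 -> compact A -> continuous (support_fun A).
Proof.
move=> A0 cA th; have [K K0 hK] := compact_enorm_le cA.
move=> U /nbhs_ballP[e /= e0 eU].
have K1 : 0 < K + 1 by rewrite ltr_wpDl.
apply: (@filterS _ (nbhs th)) (near_enorm_lt th (divr_gt0 e0 K1)) => th'.
rewrite ltr_pdivlMr // => h; apply: eU; rewrite /ball /=.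
have h1 := support_fun_lipschitz A0 cA th th' hK.
have h2 := support_fun_lipschitz A0 cA th' th hK.
have n0 := enorm_ge0 (th' - th); move: h1; rewrite (enormB th) => h1.
by rewrite ltr_norml; apply/andP; split; nra.
Qed.

Lemma support_fun_bounded A : A !=set0 -> compact A ->
  exists2 M, 0 <= M & forall th, sphere th -> `|support_fun A th| <= M.
Proof.
move=> A0 cA; have [K K0 hK] := compact_enorm_le cA; exists K => // th sth.
have h1 := support_fun_le_cball A0 K0 hK sth.
have h2 := support_fun_le_cball A0 K0 hK (sphereN sth).
have h3 := support_funD_oppr_ge0 A0 cA th.
by rewrite ler_norml h1 andbT; lra.
Qed.

Lemma support_fun_integrable A : A !=set0 -> compact A ->
  sigma.-integrable sphereB (EFin \o support_fun A).
Proof.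
move=> A0 cA; have [M _ hM] := support_fun_bounded A0 cA.
by apply: sphere_integrable hM; exact: support_fun_continuous.
Qed.

Lemma sphere_Rintegral_cst r : \int[sigma]_(th in sphereB) r = r.
Proof.
rewrite Rintegral_cst; last exact: measurable_sphere.
rewrite -[RHS]mulr1; congr (r * _); exact: (congr1 fine hsigma.1).
Qed.

Lemma mean_radius_bounds A m M : A !=set0 -> compact A ->
  (forall th, sphere th -> m <= support_fun A th <= M) -> m <= mean_radius sigma A <= M.
Proof.
move=> A0 cA h; have icst r : sigma.-integrable sphereB (EFin \o fun=> r).
  by apply: (@sphere_integrable _ `|r|) => // x; exact: cst_continuous.
rewrite -[X in X <= _ <= _]sphere_Rintegral_cst -[X in _ <= _ <= X]sphere_Rintegral_cst.
apply/andP; split; apply: le_Rintegral; try exact: measurable_sphere; try exact: icst;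
  try exact: support_fun_integrable; by move=> x /h /andP[].
Qed.

(** The support function is averaged with its reflected copy, which has the same integral since
    reflections are orthogonal and [sigma] is invariant. *)
Lemma mean_radius_minkowski_sym u A : sphere u -> A !=set0 -> compact A ->
  mean_radius sigma (minkowski_sym u A) = mean_radius sigma A.
Proof.
move=> su A0 cA; have [M M0 hM] := support_fun_bounded A0 cA.
have intA := support_fun_integrable A0 cA.
have cf := support_fun_continuous A0 cA.
have intr : sigma.-integrable sphereB (EFin \o (support_fun A \o reflection u)).
  apply: (@sphere_integrable _ M) => [th|th sth].
    by apply: continuous_comp; [exact: reflection_continuous|exact: cf].
  by apply: hM; exact: sphere_reflection.
have preS : reflection u @^-1` sphereB = sphereB.
  apply/seteqP; split => th /=; last exact: sphere_reflection.
  by move=> /(sphere_reflection su); rewrite reflectionK.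
have inv : \int[sigma]_(th in sphereB) (support_fun A \o reflection u) th =
    \int[sigma]_(th in sphereB) support_fun A th.
  have mf : measurable_fun setT (EFin \o support_fun A : borel_rV R d -> \bar R).
    by apply/measurable_EFinP; exact: continuous_measurable_rV.
  have := @integral_pushforward _ _ _ _ R _ (measurable_reflection u) sigma sphereB _ mf.
  rewrite preS => /(_ intr measurable_sphere) pushf; congr fine; rewrite -[LHS]pushf.
  apply: eq_measure_integral; first exact: measurable_reflection.
  move=> mr E mE _; rewrite /pushforward.
  have := hsigma.2 _ _ (reflection_orthogonal su) mE.
  rewrite (_ : _ @^-1` E = reflection u @^-1` E) //.
  by apply/seteqP; split => x; rewrite /= reflection_mulmx.
rewrite /mean_radius.
transitivity (\int[sigma]_(th in sphereB) (2^-1 * (support_fun A th + (support_fun A \o reflection u) th))).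
  by apply: eq_Rintegral => th _; rewrite support_fun_minkowski_sym.
rewrite RintegralZl; [|exact: measurable_sphere|]; last first.
  rewrite (_ : EFin \o _ = (EFin \o support_fun A) \+ (EFin \o (support_fun A \o reflection u)))%E //.
  by apply: integrableD => //; exact: measurable_sphere.
rewrite RintegralD //; last exact: measurable_sphere.
by rewrite inv; lra.
Qed.

End Mean_radius.

(** * Universality *)

Section Convergence.
Variables (R : realType) (d : nat).
Implicit Types (x y th : 'rV[R]_d) (A B : set 'rV[R]_d) (t w : nat -> 'rV[R]_d) (r e m M : R).

Lemma sphere_nonempty : (0 < d)%N -> exists th, @sphere R d th.
Proof.
case: d => // n _; exists (row_cons 1 0); apply: sphere_dotv.
by rewrite dotv_row_cons dot0v addr0 mulr1.
Qed.

(* [r] is the radius of the limit ball; [e0] only serves to make the lower bounds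
   that have to persist positive, as Steiner symmetrization requires. *)
Lemma support_fun_orbit (d0 : (0 < d)%N) t w (C : nat -> set 'rV[R]_d) r e0 :
  (forall n, sphere (t n)) -> @sphere R d `<=` closure (range t) ->
  (forall n, sphere (w n)) ->
  (forall N k, exists2 m, (k <= m)%N & forall i, (i <= N)%N -> w (m + i)%N = t i) ->
  (forall n, C n !=set0) -> (forall n, compact (C n)) ->
  (forall n th, sphere th -> support_fun (C n.+1) th <=
    2^-1 * (support_fun (C n) th + support_fun (C n) (reflection (w n) th))) ->
  0 < e0 ->
  (forall n m, r - e0 <= m -> (forall th, sphere th -> m <= support_fun (C n) th) ->
    forall th, sphere th -> m <= support_fun (C n.+1) th) ->
  (forall n m M, (forall th, sphere th -> m <= support_fun (C n) th <= M) -> m <= r <= M) ->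
  forall e, 0 < e -> exists N, forall n, (N <= n)%N -> forall th, sphere th ->
    `|support_fun (C n) th - r| <= e.
Proof.
move=> st dense sw block C0 cC step e00 persist target e e_gt0.
have [K K0 hK] := compact_enorm_le (cC 0%N).
have fK n th : sphere th -> support_fun (C n) th <= K.
  rewrite -[n]add0n; move: th; apply: (averaging_le sw step) => th sth.
  exact: support_fun_le_cball.
have subK n : C n `<=` cball K by apply: sub_cball_support_fun => //; exact: fK.
(* Oscillation at most [e] gives the conclusion; oscillation at most [e0] makes [M - de] at least
   [r - e0], so that [persist] applies to it. *)
pose de := Num.min e e0.
have de0 : 0 < de by rewrite lt_min e_gt0.
have [n [M hM]] : exists n M, forall th, sphere th -> M - de <= support_fun (C n) th <= M.
  apply: (@averaging_oscillation R d w (fun n => support_fun (C n)) sw step t K st dense block _ _ K0 K de de0) => [n th th' _ _|n th sth|th sth].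
  - exact: support_fun_lipschitz.
  - have := support_funD_oppr_ge0 (C0 n) (cC n) th.
    by have := fK n _ (sphereN sth); lra.
  - exact: fK.
exists n => j nj th sth.
have /andP[rlo rhi] := target n _ _ hM.
have de_e : de <= e by rewrite ge_min lexx.
have de_e0 : de <= e0 by rewrite ge_min lexx orbT.
have hi : support_fun (C j) th <= M.
  rewrite -(subnKC nj); apply: (averaging_le sw step) => // y sy.
  by case/andP: (hM _ sy).
have lo : forall y, sphere y -> M - de <= support_fun (C j) y.
  rewrite -(subnKC nj); elim: (j - n)%N => [|i IH] y sy.
    by rewrite addn0; case/andP: (hM _ sy).
  by rewrite addnS; apply: persist sy => //; lra.
have := lo _ sth; rewrite ler_norml => ?; apply/andP; split; lra.
Qed.

Lemma hausdorff_dist_ge0 A B : (0 <= hausdorff_dist A B)%E.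
Proof. by apply: le_ereal_inf_tmp => _ [r [r0 _ _] <-]; rewrite lee_fin. Qed.

Lemma hausdorff_cvg_support_fun (d0 : (0 < d)%N) (C : nat -> set 'rV[R]_d) r :
  (forall n, C n !=set0) -> (forall n, compact (C n)) -> (forall n, is_convex (C n)) ->
  (forall e, 0 < e -> exists N, forall n, (N <= n)%N -> forall th, sphere th ->
    `|support_fun (C n) th - r| <= e) ->
  forall f : nat -> nat, (forall N, exists N' : nat, forall n, (N' <= n)%N -> (N <= f n)%N) ->
  hausdorff_cvg (fun n => C (f n)) (dilate r (@unit_ball R d)).
Proof.
move=> C0 cC cvC h f hf.
have r0 : 0 <= r.
  have [th sth] := sphere_nonempty d0; rewrite leNgt; apply/negP => r0.
  (* With this tolerance the support function would be negative at both [th] and [- th], whereas the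
     sum of these two values is nonnegative. *)
  have r20 : 0 < - r / 2 by rewrite divr_gt0 // oppr_gt0.
  have [N hN] := h _ r20.
  have := support_funD_oppr_ge0 (C0 N) (cC N) th.
  have := hN _ (leqnn N) _ (sphereN sth); have := hN _ (leqnn N) _ sth.
  by rewrite !ler_norml => /andP[_ ?] /andP[_ ?]; lra.
move=> U U0; have /nbhs_ballP[e /= e0 eU] : nbhs (0 : R) (EFin @^-1` U) by [].
have [N hN] := h (e / 2) (divr_gt0 e0 (ltr0n _ 2)).
have [N' hN'] := hf N; exists N' => // n N'n.
have le_e : (hausdorff_dist (C (f n)) (dilate r (@unit_ball R d)) <= (e / 2)%:E)%E.
  by apply: hausdorff_dist_support_fun => //; [rewrite divr_ge0 // ltW|exact/hN/hN'].
move: (hausdorff_dist_ge0 (C (f n)) (dilate r (@unit_ball R d))) le_e => /=.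
case: (hausdorff_dist _ _) => [s| |] //; rewrite !lee_fin => s0 se.
apply: eU; rewrite /ball /= sub0r normrN ger0_norm //.
by apply: (le_lt_trans se); rewrite ltr_pdivrMr // mulr_natr mulr2n ltrDl.
Qed.

(** Indexed by the number of steps performed, so that it starts at [A] itself; [iter_sym F u k n]
    performs [n.+1 - k] steps. *)
Definition orbit (F : 'rV[R]_d -> set 'rV[R]_d -> set 'rV[R]_d) (u : nat -> 'rV[R]_d) k A j :=
  foldl (fun B i => F (u i) B) A (iota k j).

Lemma orbitS F u k A j : orbit F u k A j.+1 = F (u (k + j)%N) (orbit F u k A j).
Proof. by rewrite /orbit -[j.+1]addn1 iotaD foldl_cat. Qed.

Lemma hausdorff_cvg_iter_sym (d0 : (0 < d)%N) F u k A r :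
  let C := orbit F u k A in
  (forall n, C n !=set0) -> (forall n, compact (C n)) -> (forall n, is_convex (C n)) ->
  (forall e, 0 < e -> exists N, forall n, (N <= n)%N -> forall th, sphere th ->
    `|support_fun (C n) th - r| <= e) ->
  hausdorff_cvg (fun n => iter_sym F u k n A) (dilate r (@unit_ball R d)).
Proof.
move=> C C0 cC cvC h.
apply: (hausdorff_cvg_support_fun d0 C0 cC cvC h (f := fun n => (n.+1 - k)%N)) => N.
by exists (N + k)%N => n Nn; rewrite leq_subRL; [rewrite addnC leqW|rewrite leqW // (leq_trans _ Nn) // leq_addl].
Qed.

Lemma minkowski_sym_orbit u k A : A !=set0 -> compact A -> is_convex A -> forall n,
  [/\ orbit (@minkowski_sym R d) u k A n !=set0, compact (orbit (@minkowski_sym R d) u k A n) &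
      is_convex (orbit (@minkowski_sym R d) u k A n)].
Proof.
move=> A0 cA cvA; elim=> [|n [C0 cC cvC]] //; rewrite orbitS; split.
- exact: minkowski_sym_nonempty.
- exact: compact_minkowski_sym.
- exact: is_convex_minkowski_sym.
Qed.

Lemma steiner_orbit u k A : (forall n, sphere (u n)) ->
  A !=set0 -> compact A -> is_convex A -> forall n,
  [/\ orbit (@steiner R d) u k A n !=set0, compact (orbit (@steiner R d) u k A n),
      is_convex (orbit (@steiner R d) u k A n) &
      volume (orbit (@steiner R d) u k A n) = volume A].
Proof.
move=> su A0 cA cvA; elim=> [|n [C0 cC cvC volC]] //; rewrite orbitS; split.
- by rewrite steiner_pairsE //; exact: steiner_pairs_nonempty.
- by rewrite steiner_pairsE //; exact: compact_steiner_pairs.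
- by rewrite steiner_pairsE //; exact: is_convex_steiner_pairs.
- by rewrite volume_steiner.
Qed.

Lemma convex_bodyP A : convex_body A -> [/\ A !=set0, compact A & is_convex A].
Proof.
move=> [/convex_set_is_convex cvA cA [x Ax]]; split => //.
by exists x; exact: interior_subset.
Qed.

Section Universality.
Variables (t u : nat -> 'rV[R]_d).
Hypotheses (d0 : (0 < d)%N) (st : forall n, sphere (t n))
  (dense : @sphere R d `<=` closure (range t)) (su : forall n, sphere (u n))
  (block : forall N k, exists2 m, (k <= m)%N & forall i, (i <= N)%N -> u (m + i)%N = t i).

(** Universality concerns every starting index [k], so the tails of [u] must contain the blocks as
    well. *)
Lemma block_shift k N l : exists2 m, (l <= m)%N & forall i, (i <= N)%N -> u (k + (m + i))%N = t i.
Proof.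
have [m lm hm] := block N (k + l); exists (m - k)%N.
  by rewrite leq_subRL // (leq_trans (leq_addr l k)).
by move=> i iN; rewrite addnA subnKC ?hm // (leq_trans (leq_addr l k)).
Qed.

Lemma dense_blocks_M_universal (sigma : probability (borel_rV R d) R) :
  rotation_invariant_on_sphere sigma -> M_universal sigma u.
Proof.
move=> hsigma A /convex_bodyP[A0 cA cvA] k.
have orb := minkowski_sym_orbit u k A0 cA cvA.
have C0 n : orbit (@minkowski_sym R d) u k A n !=set0 by case: (orb n).
have cC n : compact (orbit (@minkowski_sym R d) u k A n) by case: (orb n).
apply: hausdorff_cvg_iter_sym => // [n|]; first by case: (orb n).
(* Averaging preserves lower bounds of either sign, so the value 1 is arbitrary. *)
apply: (support_fun_orbit d0 st dense (w := fun n => u (k + n)%N) (e0 := 1)) => //.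
- exact: block_shift.
- by move=> n th sth; rewrite orbitS support_fun_minkowski_sym.
- move=> n m _ h th sth; rewrite orbitS support_fun_minkowski_sym //.
  by have := h _ sth; have := h _ (sphere_reflection (su (k + n)) sth); lra.
- move=> n m M h.
  have -> : mean_radius sigma A = mean_radius sigma (orbit (@minkowski_sym R d) u k A n).
    by elim: n {h} => // n ->; rewrite orbitS mean_radius_minkowski_sym.
  exact: mean_radius_bounds.
Qed.

Lemma dense_blocks_S_universal : S_universal u.
Proof.
move=> A bA k; have [A0 cA cvA] := convex_bodyP bA; have [_ _ iA] := bA.
have [r0 rE] := volume_radiusP d0 cA iA; set r := volume_radius A in r0 rE *.
have orb := steiner_orbit k su A0 cA cvA.
have C0 n : orbit (@steiner R d) u k A n !=set0 by case: (orb n).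
have cC n : compact (orbit (@steiner R d) u k A n) by case: (orb n).
have cvC n : is_convex (orbit (@steiner R d) u k A n) by case: (orb n).
have CS n : orbit (@steiner R d) u k A n.+1 = steiner_pairs (u (k + n)%N) (orbit (@steiner R d) u k A n).
  by rewrite orbitS steiner_pairsE.
have volC n : volume (@cball R d r) = volume (orbit (@steiner R d) u k A n).
  by case: (orb n) => _ _ _ ->.
apply: hausdorff_cvg_iter_sym => //.
(* With [e0 := r] the persisting lower bounds are nonnegative, hence radii of balls contained in the
   body. *)
apply: (support_fun_orbit d0 st dense (w := fun n => u (k + n)%N) (e0 := r)) => //.
- exact: block_shift.
- move=> n th sth; rewrite -support_fun_minkowski_sym // CS.
  apply: support_fun_le; first exact: steiner_pairs_nonempty.
  move=> x /steiner_pairs_sub_minkowski_sym; apply: support_fun_ge.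
  exact: compact_minkowski_sym.
- move=> n m; rewrite subrr => m0 h th sth.
  apply: cball_sub_support_fun_ge => //.
  by rewrite CS; apply: cball_sub_steiner_pairs => //; exact: cball_sub_support_fun.
- move=> n m M h; have mC := @measurable_compact_rV R d.
  have M0 : 0 <= M.
    have [th sth] := sphere_nonempty d0.
    have := support_funD_oppr_ge0 (C0 n) (cC n) th.
    by have /andP[_ ?] := h _ sth; have /andP[_ ?] := h _ (sphereN sth); lra.
  apply/andP; split; rewrite leNgt; apply/negP => lt.
    have m0 : 0 < m by exact: lt_trans lt.
    have := volume_cball_lt d0 r0 lt; rewrite (volC n) ltNge => /negP; apply.
    apply: le_volume; [apply: mC; exact: compact_cball|exact: mC|].
    by apply: cball_sub_support_fun => // th /h /andP[].
  (* [M] itself might be 0, while comparing volumes of balls requires a positive radius; this one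
     lies strictly between [M] and [r]. *)
  have M'0 : 0 < (M + r) / 2 by rewrite divr_gt0 // ltr_wpDl.
  have M'r : (M + r) / 2 < r by lra.
  have := volume_cball_lt d0 M'0 M'r; rewrite (volC n) ltNge => /negP; apply.
  apply: le_volume; [exact: mC|apply: mC; exact: compact_cball|].
  apply: sub_cball_support_fun => //; first exact: ltW.
  by move=> th /h /andP[_ ?]; lra.
Qed.

End Universality.

Lemma countable_range (T : set 'rV[R]_d) x0 : T x0 -> countable T ->
  exists t : nat -> 'rV[R]_d, range t = T.
Proof.
move=> Tx0 /countable_injP[f finj].
(* Integers not reached by the injection [f] are sent to [x0], which keeps all values in [T]. *)
exists (fun n => xget x0 [set x | T x /\ f x = n]); apply/seteqP; split => [_ [n _ <-]|x Tx].
  by case: xgetP => [x _ []|].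
exists (f x) => //; case: xgetP => [y _ [Ty /finj]|/(_ x)[]//].
by rewrite !inE; apply.
Qed.

End Convergence.

Theorem proposition3 (R : realType) (d : nat) (hd : (0 < d)%N)
    (sigma : probability (borel_rV R d) R)
    (hsigma : rotation_invariant_on_sphere sigma)
    (T : set 'rV[R]_d) (T_countable : countable T)
    (T_sphere : T `<=` @sphere R d)
    (T_dense : @sphere R d `<=` closure T) :
  exists u : nat -> 'rV[R]_d, (forall n, T (u n)) /\ universal sigma u.
Proof.
have [th sth] := sphere_nonempty R hd.
have [x0 [Tx0 _]] := T_dense _ sth _ filterT.
have [t tT] := countable_range Tx0 T_countable.
have Tt n : T (t n) by rewrite -tT; exists n.
have dense : @sphere R d `<=` closure (range t) by rewrite tT.
have block N k : exists2 m, (k <= m)%N & forall i, (i <= N)%N -> t (block_index (m + i)) = t i.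
  by have [m km hm] := block_indexP N k; exists m => // i /hm ->.
have st n : sphere (t n) by exact: T_sphere.
exists (fun n => t (block_index n)); split => [n|]; first exact: Tt.
split; first by move=> n; exact: st.
- exact: (dense_blocks_S_universal hd st dense).
- exact: (dense_blocks_M_universal hd st dense).
Qed.
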